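(* The following are highest-weight vectors, of the indicated weights, for all irreducible components of $S^3(\mathfrak{gl}_n)$, counted with multiplicity (all sums over indices $i,j,k$ run over $1,\ldots,n$): \begin{itemize} \item weight $[0,\ldots,0]$: $III$; $\ \sum_{i,j} I E_{i,j}E_{j,i}$; $\ \sum_{i,j,k}E_{i,j}E_{j,k}E_{k,i}$; \item weight $[1,0,\ldots,0,-1]$: $IIE_{1,n}$; $\ \sum_i I E_{1,i}E_{i,n}$; $\ \sum_{i,j}E_{1,n}E_{i,j}E_{j,i}$; $\ \sum_{i,j}E_{1,i}E_{i,j}E_{j,n}$; \item weight $[2,0,\ldots,0,-2]$: $IE_{1,n}E_{1,n}$; $\ \sum_i E_{1,n}E_{1,i}E_{i,n}$; \item weight $[1,1,0,\ldots,0,-2]$: $\sum_i \left(E_{1,n}E_{2,i}E_{i,n}-E_{2,n}E_{1,i}E_{i,n}\right)$; \item weight $[2,0,\ldots,0,-1,-1]$: $\sum_i\left(E_{1,n}E_{1,i}E_{i,n-1}-E_{1,n-1}E_{1,i}E_{i,n}\right)$; \item weight $[1,1,0,\ldots,0,-1,-1]$: $IE_{1,n}E_{2,n-1}-IE_{1,n-1}E_{2,n}$; $\ \sum_i\left(E_{1,n}E_{2,i}E_{i,n-1}-E_{2,n}E_{1,i}E_{i,n-1}-E_{1,n-1}E_{2,i}E_{i,n}+E_{2,n-1}E_{1,i}E_{i,n}\right)$; \item weight $[3,0,\ldots,0,-3]$: $E_{1,n}E_{1,n}E_{1,n}$; \item weight $[2,1,0,\ldots,0,-1,-2]$: $E_{1,n}E_{1,n-1}E_{2,n}-E_{1,n}E_{1,n}E_{2,n-1}$;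 \item weight $[1,1,1,0,\ldots,0,-1,-1,-1]$: $\sum_{\sigma\in S_3}\operatorname{sgn}(\sigma)\,E_{\sigma(1),n}E_{\sigma(2),n-1}E_{\sigma(3),n-2}$. \end{itemize}
   Context: The ground field is $\mathbb{C}$ and $n\in\mathbb{N}$. $\mathfrak{gl}_n$ is the space of $n\times n$ complex matrices with the conjugation action of $GL_n$ (and of $SL_n$); $S^3(\mathfrak{gl}_n)$ is its third symmetric power, and juxtaposition denotes the commutative product in the symmetric algebra of $\mathfrak{gl}_n$ (not the matrix product). $E_{i,j}\in\mathfrak{gl}_n$ is the matrix whose only nonzero entry is a $1$ in position $(i,j)$, and $I=\sum_i E_{i,i}$ is the identity matrix. With $e_i$ the $i$-th standard basis vector of $\mathbb{Z}^n$, the vector $E_{i,j}E_{i',j'}E_{i'',j''}$ has weight $e_i+e_{i'}+e_{i''}-e_j-e_{j'}-e_{j''}$. A highest-weight vector is a nonzero weight vector annihilated by the Lie algebra action of every matrix $E_{i,i+1}$, where $X$ acts on $\mathfrak{gl}_n$ by $Y\mapsto XY-YX$ and on $S^3(\mathfrak{gl}_n)$ by the Leibniz rule.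
   Formalization: The claim is proved for n ≥ 6 only; for smaller n the weight [1,1,1,0,…,0,-1,-1,-1] is not a vector of length n and the list fails (for n = 1 the three vectors of weight 0 coincide while S^3(gl_1) is one-dimensional). *)

(* Defs.v *)
From HB Require Import structures.
From mathcomp Require Import all_boot all_order all_fingroup all_algebra.
From mathcomp Require Import mpoly complex.
From mathcomp Require Import reals.

Set Implicit Arguments.
Unset Strict Implicit.
Unset Printing Implicit Defensive.

Import GRing.Theory.
Local Open Scope ring_scope.

(* multinomials only declares the homogeneous polynomials of a given degree to be
   finite dimensional when the number of variables is a successor. *)
Fact dhomog3_vecaxiom (K : fieldType) (N : nat) :
  Vector.axiom 'C(N.+2, 3) (dhomog N K 3).
Proof.
case: N => [|N]; last exact: (@dhomog_vecaxiom N K 3).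
exists (fun=> 0) => [a u v|]; first by rewrite scaler0 addr0.
exists (fun=> 0) => [u|v]; last by rewrite [RHS]thinmx0.
apply/val_inj/mpolyP => m /=; rewrite mcoeff0.
apply/esym/(dhomog_nemf_coeff (dhomog_is_dhomog u)).
by have -> : m = 0%MM by [apply/mnmP => -[]]; rewrite /= mdeg0.
Qed.

Section ThirdSymmetricPower.
Variables (K : fieldType) (n : nat).

(* The symmetric algebra of gl_n is the polynomial ring on the basis of matrix
   units: the variable of index [mxvec_index i j] is the matrix unit with a 1 in
   row i and column j, and S^3(gl_n) is the homogeneous component of degree 3. *)
Definition S3gl : Type := dhomog (n * n) K 3.

HB.instance Definition _ := GRing.Lmodule.on S3gl.

HB.instance Definition _ :=
  Lmodule_hasFinDim.Build K S3gl (dhomog3_vecaxiom K (n * n)).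

Definition gl_var (A : 'M[K]_n) : {mpoly K[n * n]} :=
  \sum_i \sum_j A i j *: 'X_(mxvec_index i j).

Lemma gl_var_homog A : gl_var A \is 1%N.-homog.
Proof.
by rewrite rpred_sum // => i _; rewrite rpred_sum // => j _;
  rewrite rpredZ // dhomogX /= mdeg1.
Qed.

Fact prod3_homog (A B C : 'M[K]_n) :
  gl_var A * gl_var B * gl_var C \is 3%N.-homog.
Proof.
by apply: (dhomogM (d := 2%N) (e := 1%N));
  [apply: (dhomogM (d := 1%N) (e := 1%N))|]; apply: gl_var_homog.
Qed.

(* The commutative product A B C in S^3(gl_n) *)
Definition prod3 (A B C : 'M[K]_n) : S3gl := DHomog (prod3_homog A B C).

(* GL_n acts on S^3(gl_n) by Y |-> g Y g^-1 on each variable. *)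
Definition conj_poly (g : 'M[K]_n) (p : {mpoly K[n * n]}) : {mpoly K[n * n]} :=
  p \mPo [tuple gl_var (g *m vec_mx (delta_mx 0 k) *m invmx g) | k < n * n].

Fact conj_poly_homog g (p : S3gl) :
  conj_poly g (mpoly_of_dhomog p) \is 3%N.-homog.
Proof.
rewrite /conj_poly comp_mpolyE big_seq rpred_sum // => m mp; rewrite rpredZ //.
have <- : mdeg m = 3%N by apply: (dhomog_mf (dhomog_is_dhomog p)).
rewrite mdegE.
apply: (big_ind2 (fun (q : {mpoly K[n * n]}) d => q \is d.-homog)) => [||k _].
- exact: dhomog1.
- by move=> ? ? ? ? hq hr; exact: dhomogM.
- by rewrite -{2}[m k]mul1n; apply: dhomogMn; rewrite tnth_mktuple gl_var_homog.
Qed.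

Definition GLact (g : 'M[K]_n) (p : S3gl) : S3gl :=
  DHomog (conj_poly_homog g p).

(* The Lie algebra action: X acts by the derivation of the symmetric algebra
   that extends Y |-> X Y - Y X. *)
Definition bracket_poly (X : 'M[K]_n) (p : {mpoly K[n * n]}) :
    {mpoly K[n * n]} :=
  \sum_i \sum_j
    gl_var (X *m delta_mx i j - delta_mx i j *m X) * mderiv (mxvec_index i j) p.

Fact bracket_poly_homog X (p : S3gl) :
  bracket_poly X (mpoly_of_dhomog p) \is 3%N.-homog.
Proof.
rewrite rpred_sum // => i _; rewrite rpred_sum // => j _.
apply: (dhomogM (d := 1%N) (e := 2%N)); first exact: gl_var_homog.
rewrite /mderiv big_seq rpred_sum // => m mp; set k := mxvec_index i j.
have [mk0|mk_gt0] := posnP (m k); first by rewrite mk0 mul0r scale0r rpred0.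
have dm : mdeg m = 3%N by apply: (dhomog_mf (dhomog_is_dhomog p)).
rewrite rpredZ // dhomogX /=; move: dm.
by rewrite -{1}[m](@submK _ U_(k)) ?lep1mP -?lt0n // mdegD mdeg1 addn1 => -[->].
Qed.

Definition glact (X : 'M[K]_n) (p : S3gl) : S3gl :=
  DHomog (bracket_poly_homog X p).

Fact mderiv_gl_var A i j :
  mderiv (mxvec_index i j) (gl_var A) = (A i j)%:MP.
Proof.
have mderivU (k l : 'I_(n * n)) :
    mderiv k ('X_l : {mpoly K[n * n]}) = (l == k)%:R%:MP.
  rewrite mderivX mnmE; case: eqP => [->|_] /=; last by rewrite scale0r.
  have -> : (U_(k) - U_(k))%MM = 0%MM.
    by apply/mnmP => x; rewrite mnmBE subnn mnm0E.
  by rewrite scale1r mpolyX0.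
rewrite raddf_sum (bigD1 i) //= [X in _ + X]big1 ?addr0; last first.
  move=> a ai; rewrite raddf_sum big1 //= => b _; rewrite mderivZ mderivU.
  suff /negPf-> : mxvec_index a b != mxvec_index i j by rewrite scaler0.
  apply: contra_neq ai => /(congr1 (fun k => (vec_mx (delta_mx 0 k) : 'M[K]_n))).
  rewrite !vec_mx_delta => /matrixP/(_ a b); rewrite !mxE !eqxx /=.
  by case: eqP => // _ /eqP; rewrite oner_eq0.
rewrite raddf_sum (bigD1 j) //= [X in _ + X]big1 ?addr0; last first.
  move=> b bj; rewrite mderivZ mderivU.
  suff /negPf-> : mxvec_index i b != mxvec_index i j by rewrite scaler0.
  apply: contra_neq bj => /(congr1 (fun k => (vec_mx (delta_mx 0 k) : 'M[K]_n))).
  rewrite !vec_mx_delta => /matrixP/(_ i b); rewrite !mxE !eqxx /=.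
  by case: eqP => // _ /eqP; rewrite oner_eq0.
by rewrite mderivZ mderivU eqxx -mul_mpolyC -mpolyCM mulr1.
Qed.

Fact gl_var_is_linear : linear gl_var.
Proof.
move=> a A B; rewrite scaler_sumr -big_split; apply: eq_bigr => i _.
rewrite scaler_sumr -big_split; apply: eq_bigr => j _ /=.
by rewrite !mxE scalerDl scalerA.
Qed.

HB.instance Definition _ :=
  GRing.isLinear.Build K 'M[K]_n {mpoly K[n * n]} _ gl_var gl_var_is_linear.

(* On products of three matrices both actions are the expected ones. *)
Fact glact_prod3 X A B C :
  glact X (prod3 A B C) =
    prod3 (X *m A - A *m X) B C + prod3 A (X *m B - B *m X) C
    + prod3 A B (X *m C - C *m X).
Proof.
have bracket_var D : bracket_poly X (gl_var D) = gl_var (X *m D - D *m X).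
  rewrite [in RHS](matrix_sum_delta D) mulmx_sumr mulmx_suml -sumrB linear_sum.
  apply: eq_bigr => i _; rewrite mulmx_sumr mulmx_suml -sumrB linear_sum.
  apply: eq_bigr => j _; rewrite mderiv_gl_var mulrC mul_mpolyC.
  by rewrite -scalemxAl -scalemxAr -scalerBr linearZ.
have bracketM p q :
    bracket_poly X (p * q) = bracket_poly X p * q + p * bracket_poly X q.
  rewrite mulr_suml mulr_sumr -big_split; apply: eq_bigr => i _.
  rewrite mulr_suml mulr_sumr -big_split; apply: eq_bigr => j _ /=.
  by rewrite mderivM mulrDr !mulrA [p * _]mulrC.
apply: val_inj => /=; rewrite !bracketM !bracket_var mulrDl.
by [].
Qed.

Fact GLact_prod3 g A B C :
  GLact g (prod3 A B C) =
    prod3 (g *m A *m invmx g) (g *m B *m invmx g) (g *m C *m invmx g).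
Proof.
have conj_var D : conj_poly g (gl_var D) = gl_var (g *m D *m invmx g).
  rewrite [in RHS](matrix_sum_delta D) mulmx_sumr mulmx_suml linear_sum.
  rewrite /conj_poly linear_sum; apply: eq_bigr => i _.
  rewrite mulmx_sumr mulmx_suml !linear_sum; apply: eq_bigr => j _ /=.
  rewrite -scalemxAr -scalemxAl !linearZ /= comp_mpolyXU -tnth_nth.
  by rewrite tnth_mktuple vec_mx_delta.
by apply: val_inj; rewrite /= /conj_poly !rmorphM /= -!/(conj_poly _ _) !conj_var.
Qed.

Definition mnm_weight (m : 'X_{1..n * n}) : 'rV[int]_n :=
  \sum_i \sum_j (delta_mx 0 i - delta_mx 0 j) *+ m (mxvec_index i j).

Definition has_weight (lam : 'rV[int]_n) (p : S3gl) : Prop :=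
  {in msupp (mpoly_of_dhomog p), forall m, mnm_weight m = lam}.

(* The matrix unit E_{i,j}, with i and j running over 1, ..., n as usual
   (the matrix is zero when i or j is out of this range). *)
Definition E (i j : nat) : 'M[K]_n :=
  \matrix_(a, b) ((a.+1 == i) && (b.+1 == j))%:R.

Definition highest_weight_vector (lam : 'rV[int]_n) (p : S3gl) : Prop :=
  [/\ p != 0, has_weight lam p
    & forall i, (1 <= i < n)%N -> glact (E i i.+1) p = 0].

Definition GLstable (W : {vspace S3gl}) : Prop :=
  forall g, g \in unitmx -> forall p, p \in W -> GLact g p \in W.

Definition GLirreducible (W : {vspace S3gl}) : Prop :=
  [/\ W != 0%VS, GLstable W
    & forall U : {vspace S3gl}, GLstable U -> (U <= W)%VS ->
        U = 0%VS \/ U = W].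

(* The weight [a_1, ..., a_r, 0, ..., 0, b_1, ..., b_s] of length n. *)
Definition weight (a b : seq int) : 'rV[int]_n :=
  \row_k nth 0 (a ++ nseq (n - (size a + size b)) 0 ++ b) k.

End ThirdSymmetricPower.

Arguments E {K n} i j.

Definition listed_vectors (K : fieldType) (n : nat) :
    seq ('rV[int]_n * S3gl K n) :=
  let I := 1%:M : 'M[K]_n in
  let w := @weight n in
  [:: (w [::] [::], prod3 I I I);
      (w [::] [::],
        \sum_(1 <= i < n.+1) \sum_(1 <= j < n.+1) prod3 I (E i j) (E j i));
      (w [::] [::],
        \sum_(1 <= i < n.+1) \sum_(1 <= j < n.+1) \sum_(1 <= k < n.+1)
          prod3 (E i j) (E j k) (E k i));

      (w [:: 1] [:: -1], prod3 I I (E 1 n));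
      (w [:: 1] [:: -1], \sum_(1 <= i < n.+1) prod3 I (E 1 i) (E i n));
      (w [:: 1] [:: -1],
        \sum_(1 <= i < n.+1) \sum_(1 <= j < n.+1)
          prod3 (E 1 n) (E i j) (E j i));
      (w [:: 1] [:: -1],
        \sum_(1 <= i < n.+1) \sum_(1 <= j < n.+1)
          prod3 (E 1 i) (E i j) (E j n));

      (w [:: 2] [:: -2], prod3 I (E 1 n) (E 1 n));
      (w [:: 2] [:: -2], \sum_(1 <= i < n.+1) prod3 (E 1 n) (E 1 i) (E i n));

      (w [:: 1; 1] [:: -2],
        \sum_(1 <= i < n.+1)
          (prod3 (E 1 n) (E 2 i) (E i n) - prod3 (E 2 n) (E 1 i) (E i n)));

      (w [:: 2] [:: -1; -1],
        \sum_(1 <= i < n.+1)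
          (prod3 (E 1 n) (E 1 i) (E i (n - 1))
           - prod3 (E 1 (n - 1)) (E 1 i) (E i n)));

      (w [:: 1; 1] [:: -1; -1],
        prod3 I (E 1 n) (E 2 (n - 1)) - prod3 I (E 1 (n - 1)) (E 2 n));
      (w [:: 1; 1] [:: -1; -1],
        \sum_(1 <= i < n.+1)
          (prod3 (E 1 n) (E 2 i) (E i (n - 1))
           - prod3 (E 2 n) (E 1 i) (E i (n - 1))
           - prod3 (E 1 (n - 1)) (E 2 i) (E i n)
           + prod3 (E 2 (n - 1)) (E 1 i) (E i n)));

      (w [:: 3] [:: -3], prod3 (E 1 n) (E 1 n) (E 1 n));

      (w [:: 2; 1] [:: -1; -2],
        prod3 (E 1 n) (E 1 (n - 1)) (E 2 n)
        - prod3 (E 1 n) (E 1 n) (E 2 (n - 1)));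

      (* 'S_3 permutes 0, 1, 2, hence the shift by one *)
      (w [:: 1; 1; 1] [:: -1; -1; -1],
        \sum_(s : 'S_3) (-1) ^+ s *:
          prod3 (E (s (inord 0)).+1 n) (E (s (inord 1)).+1 (n - 1))
                (E (s (inord 2)).+1 (n - 2)))].

(* Main.v *)
Require Import Defs.
From HB Require Import structures.
From mathcomp Require Import all_boot all_order all_fingroup all_algebra.
From mathcomp Require Import mpoly complex.
From mathcomp Require Import boolp reals.
From mathcomp Require Import ring zify.

(** A vector p of S^3(gl_n) is encoded by the tensor of its third partial
    derivatives, on which E_{a,b} acts one matrix slot at a time; the Hermitian
    form of these tensors makes E_{b,a} the adjoint of E_{a,b}.

    If v is a highest-weight vector, the span of the vectors obtained from v by
    lowering operators is stable under gl_n, hence under GL_n (transvections are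
    exponentials, and transvections and diagonal matrices generate GL_n).  A
    vector killed by the raising operators that is orthogonal to a family of
    highest-weight vectors is orthogonal to all the submodules they generate, so
    such vectors in the sum of these submodules are combinations of the family.
    As every nonzero stable subspace contains a vector killed by the raising
    operators, irreducibility and directness follow, and the sum is everything
    as soon as the family spans all the vectors killed by the raising operators.

    For the latter, sixteen entries of the tensor are dual to the sixteen listed
    vectors.  A tensor killed by the raising operators is determined by the
    entries whose indices are among 1, 2, 3, n-2, n-1, n; if the sixteen entries
    vanish, so do all these, each being forced to vanish by an invariance
    relation whose other terms are already known to vanish.  This last step only
    involves six ordered indices and is a finite computation. *)

Set Implicit Arguments.
Unset Strict Implicit.
Unset Printing Implicit Defensive.

Import Order.TTheory GRing.Theory Num.Theory.
Local Open Scope ring_scope.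

(** * Products of three matrices *)

Section Prod3.
Variables (K : fieldType) (n : nat).
Implicit Types (A B C X : 'M[K]_n) (p q : S3gl K n).

Lemma val_prod3 A B C :
  mpoly_of_dhomog (prod3 A B C) = gl_var A * gl_var B * gl_var C.
Proof. by []. Qed.

Lemma S3gl_eq p q : mpoly_of_dhomog p = mpoly_of_dhomog q -> p = q.
Proof. exact: val_inj. Qed.

Lemma val_S3glD p q :
  mpoly_of_dhomog (p + q) = mpoly_of_dhomog p + mpoly_of_dhomog q.
Proof. by []. Qed.

Lemma val_S3glZ a p : mpoly_of_dhomog (a *: p) = a%:MP * mpoly_of_dhomog p.
Proof. by rewrite mul_mpolyC. Qed.

Lemma gl_varD A B : gl_var (A + B) = gl_var A + gl_var B.
Proof. exact: linearD. Qed.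

Lemma gl_varB A B : gl_var (A - B) = gl_var A - gl_var B.
Proof. exact: linearB. Qed.

Lemma gl_varZ a A : gl_var (a *: A) = a%:MP * gl_var A.
Proof. by rewrite linearZ mul_mpolyC. Qed.

(** The slot that varies comes last, so that linearity in it can be declared for a partial
    application. *)
Definition prod3_at1 B C A := prod3 A B C.
Definition prod3_at2 A C B := prod3 A B C.

Fact prod3_linear1 B C : linear (prod3_at1 B C).
Proof.
move=> a A A'; apply/val_inj => /=.
by rewrite linearP mulrDl -scalerAl mulrDl -scalerAl.
Qed.
HB.instance Definition _ B C :=
  GRing.isLinear.Build K _ _ _ (prod3_at1 B C) (prod3_linear1 B C).

Fact prod3_linear2 A C : linear (prod3_at2 A C).
Proof.
move=> a B B'; apply/val_inj => /=.
by rewrite linearP mulrDr -scalerAr mulrDl -scalerAl.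
Qed.
HB.instance Definition _ A C :=
  GRing.isLinear.Build K _ _ _ (prod3_at2 A C) (prod3_linear2 A C).

Fact prod3_linear3 A B : linear (prod3 A B).
Proof.
move=> a C C'; apply/val_inj => /=.
by rewrite linearP mulrDr -scalerAr.
Qed.
HB.instance Definition _ A B :=
  GRing.isLinear.Build K _ _ _ (prod3 A B) (prod3_linear3 A B).

Fact glact_linear X : linear (glact X).
Proof.
move=> a p q; apply/val_inj; rewrite [RHS]linearP /= /bracket_poly.
rewrite scaler_sumr -big_split; apply: eq_bigr => i _.
rewrite scaler_sumr -big_split; apply: eq_bigr => j _ /=.
by rewrite linearP mulrDr -scalerAr.
Qed.
HB.instance Definition _ X :=
  GRing.isLinear.Build K _ _ _ (glact X) (glact_linear X).

Fact GLact_linear X : linear (GLact X).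
Proof.
move=> a p q; apply/val_inj; rewrite [RHS]linearP /= /conj_poly.
by rewrite linearP.
Qed.
HB.instance Definition _ X :=
  GRing.isLinear.Build K _ _ _ (GLact X) (GLact_linear X).

Lemma mnm_deg3 (N : nat) (m : 'X_{1..N}) : mdeg m = 3%N ->
  exists a b c : 'I_N, m = (U_(a) + U_(b) + U_(c))%MM.
Proof.
move=> m3.
have split1 (k : nat) (m' : 'X_{1..N}) : mdeg m' = k.+1 ->
    exists a m'', m' = (m'' + U_(a))%MM /\ mdeg m'' = k.
  move=> dm; have [a ma] : exists a, (m' a != 0)%N.
    apply/existsP; rewrite -[[exists _, _]]negbK negb_exists; apply/negP => /forallP h.
    move: dm; rewrite mdegE big1 // => i _; apply/eqP; have := h i.
    by rewrite negbK.
  exists a, (m' - U_(a))%MM.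
  have e : m' = (m' - U_(a) + U_(a))%MM by rewrite submK // lep1mP.
  by split=> //; move: dm; rewrite {1}e mdegD mdeg1 addn1 => -[].
have [c [m2 [-> d2]]] := split1 _ _ m3.
have [b [m1 [-> d1]]] := split1 _ _ d2.
have [a [m0 [-> d0]]] := split1 _ _ d1.
by exists a, b, c; move/eqP: d0; rewrite mdeg_eq0 => /eqP->; rewrite add0m.
Qed.

Lemma gl_var_delta (i j : 'I_n) :
  gl_var (delta_mx i j : 'M[K]_n) = 'X_(mxvec_index i j).
Proof.
rewrite /gl_var (bigD1 i) //= (bigD1 j) //= mxE !eqxx scale1r.
rewrite big1 ?addr0 => [|k kj]; last by rewrite mxE eqxx (negPf kj) scale0r.
rewrite big1 ?addr0 => // k ki; apply: big1 => l _.
by rewrite mxE (negPf ki) scale0r.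
Qed.

Lemma val_indhomog3 (m : 'X_{1..n * n}) : mdeg m = 3%N ->
  mpoly_of_dhomog (indhomog 3 'X_[m] : S3gl K n) = 'X_[m].
Proof.
move=> m3; rewrite -[LHS]/(val _) val_insubd.
by case: ifP => //; rewrite dhomogX /= m3.
Qed.

(** A monomial of degree 3 is a product of three matrix units, so products span. Identities between
    linear maps on S^3(gl_n) are thereby reduced to products of three matrices. *)
Lemma S3gl_ind (P : S3gl K n -> Prop) :
  (forall a p q, P p -> P q -> P (a *: p + q)) ->
  (forall A B C, P (prod3 A B C)) -> forall p, P p.
Proof.
move=> PD P3 p.
have P0 : P 0 by rewrite -(linear0 (prod3 0 0)); apply: P3.
have -> : p = \sum_(m <- msupp (mpoly_of_dhomog p))
               (mpoly_of_dhomog p)@_m *: indhomog 3 'X_[m].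
  apply/val_inj; rewrite /= linear_sum [LHS]mpolyE /=.
  apply: eq_big_seq => m mp; rewrite [RHS]linearZ /=; congr (_ *: _).
  have m3 := dhomog_mf (dhomog_is_dhomog p) mp.
  by rewrite val_indhomog3 //; case: 'X_[m].
rewrite big_seq; elim/big_rec: _ => // m q mp Pq.
apply: PD => //.
have m3 := dhomog_mf (dhomog_is_dhomog p) mp.
have [a [b [c em]]] := mnm_deg3 m3.
case/mxvec_indexP: a em => a1 a2; case/mxvec_indexP: b => b1 b2.
case/mxvec_indexP: c => c1 c2 em.
have -> : indhomog 3 'X_[m] =
  prod3 (delta_mx a1 a2) (delta_mx b1 b2) (delta_mx c1 c2) :> S3gl K n.
  apply: val_inj.
  by rewrite [LHS]val_indhomog3 // [RHS]val_prod3 !gl_var_delta em !mpolyXD.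
exact: P3.
Qed.

End Prod3.

(** * Generation of GL_n *)

Section Generation.
Variables (K : fieldType) (n : nat) (P : 'M[K]_n -> Prop).
Hypothesis PM : forall g h, g \in unitmx -> h \in unitmx -> P g -> P h -> P (g *m h).
Hypothesis Pt : forall a b t, a != b -> P (1%:M + t *: delta_mx a b).
Hypothesis Pd : forall d : 'rV[K]_n, (forall i, d 0 i != 0) -> P (diag_mx d).
Variable (k : 'I_n).

(** Left multiplication by 1 + [elim_mx u] adds u i times row k to each other row i and leaves row k
    alone. *)
Definition elim_mx (u : 'I_n -> K) : 'M[K]_n :=
  \matrix_(i, j) (u i * (i != k)%:R * (j == k)%:R).

Lemma elim_mulmx u (g : 'M[K]_n) i j :
  (elim_mx u *m g) i j = u i * (i != k)%:R * g k j.
Proof.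
rewrite mxE (bigD1 k) //= big1 ?addr0 => [|l lk]; first by rewrite mxE eqxx mulr1.
by rewrite mxE (negPf lk) mulr0 mul0r.
Qed.

(** Row k of [elim_mx v] is zero, so the product of two such matrices vanishes. *)
Lemma elim_mx_inv u v : (1%:M + elim_mx u) *m (1%:M + elim_mx v) =
  1%:M + elim_mx (fun i => u i + v i).
Proof.
rewrite mulmxDl mul1mx mulmxDr mulmx1; apply/matrixP => i j.
move: (elim_mulmx u (elim_mx v) i j); move: (elim_mx u *m elim_mx v) => M.
by rewrite !mxE eqxx /= => ->; ring.
Qed.

Lemma elim_mx_unit u : 1%:M + elim_mx u \in unitmx.
Proof.
have : (1%:M + elim_mx u) *m (1%:M + elim_mx (fun i => - u i)) = 1%:M.
  rewrite elim_mx_inv (_ : elim_mx _ = 0) ?addr0 //.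
  by apply/matrixP => i j; rewrite !mxE subrr !mul0r.
by case/mulmx1_unit.
Qed.

Lemma P_elim u : P (1%:M + elim_mx u).
Proof.
(* Restricting u to a list of rows allows an induction that splits off one transvection per row. *)
have -> : elim_mx u = elim_mx (fun i => u i * (i \in enum 'I_n)%:R).
  by apply/matrixP => i j; rewrite !mxE mem_enum mulr1.
elim: (enum 'I_n) (enum_uniq 'I_n) => [_|i s IHs /= /andP[nis us]].
  have -> : 1%:M + elim_mx (fun i => u i * (i \in [::])%:R) = diag_mx (const_mx 1).
    by apply/matrixP => i j; rewrite !mxE mulr0 !mul0r addr0 mulrb.
  by apply: Pd => i; rewrite mxE oner_eq0.
have -> : elim_mx (fun j => u j * (j \in i :: s)%:R) =
  elim_mx (fun j => (u i * (j == i)%:R) + u j * (j \in s)%:R).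
  apply/matrixP => j l; rewrite !mxE inE; congr (_ * _ * _).
  have [->|_] := eqVneq j i; first by rewrite (negPf nis) mulr0 addr0.
  by rewrite mulr0 add0r.
rewrite -elim_mx_inv; have [ik|ik] := eqVneq i k.
  rewrite (_ : elim_mx (fun j => u i * (j == i)%:R) = 0).
    by rewrite addr0 mul1mx; apply: IHs.
  by apply/matrixP => j l; rewrite !mxE ik; case: eqP => _; rewrite ?mulr0 ?mul0r.
apply: PM; rewrite ?elim_mx_unit //; last exact: IHs.
rewrite (_ : elim_mx _ = u i *: delta_mx i k); first exact: Pt.
apply/matrixP => j l; rewrite !mxE; have [->|_] := eqVneq j i.
  by rewrite ik !mulr1.
by rewrite /= !mulr0n !(mulr0, mul0r).
Qed.

(** One step of Gaussian elimination with pivot g k k: g factors as an elimination matrix, a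
    diagonal matrix and a matrix h whose columns up to k are those of the identity. *)
Lemma clear_column (g : 'M[K]_n) : g \in unitmx -> g k k != 0 ->
  (forall i j : 'I_n, (j < k)%N -> g i j = (i == j)%:R) ->
  (forall h, h \in unitmx ->
    (forall i j : 'I_n, (j <= k)%N -> h i j = (i == j)%:R) -> P h) -> P g.
Proof.
move=> gu gk gcol Ph.
pose d : 'rV[K]_n := \row_i (if i == k then g k k else 1).
have d0 i : d 0 i != 0 by rewrite mxE; case: ifP => _; rewrite ?oner_eq0.
pose u i := g i k / g k k.
pose e : 'rV[K]_n := \row_i (d 0 i)^-1.
have de : diag_mx d *m diag_mx e = 1%:M.
  apply/matrixP => i j; rewrite mul_diag_mx !mxE; have [->|_] := eqVneq i j.
    by rewrite !mulr1n divff //; have := d0 j; rewrite mxE.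
  by rewrite !mulr0n mulr0.
have uv : (1%:M + elim_mx u) *m (1%:M + elim_mx (fun i => - u i)) = 1%:M.
  rewrite elim_mx_inv (_ : elim_mx _ = 0) ?addr0 //.
  by apply/matrixP => i j; rewrite !mxE subrr !mul0r.
have [du eu] := mulmx1_unit de; have [uu vu] := mulmx1_unit uv.
pose h := diag_mx e *m ((1%:M + elim_mx (fun i => - u i)) *m g).
have -> : g = (1%:M + elim_mx u) *m (diag_mx d *m h).
  by rewrite /h [diag_mx d *m _]mulmxA de mul1mx mulmxA uv mul1mx.
have hu : h \in unitmx by rewrite !unitmx_mul eu vu.
apply: PM => //; [by rewrite unitmx_mul du | exact: P_elim | apply: PM => //].
  exact: Pd.
have hE i j : h i j = (if i == k then g k k else 1)^-1 *
    (g i j - u i * (i != k)%:R * g k j).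
  rewrite /h mul_diag_mx mulmxDl mul1mx.
  move: (elim_mulmx (fun i => - u i) g i j); move: (elim_mx _ *m g) => M EM.
  by rewrite !mxE EM !mulNr.
apply: Ph => // i j; rewrite hE /u leq_eqVlt => /predU1P[/val_inj->|jk].
  have [->|_] := eqVneq i k; first by rewrite mulr0 mul0r subr0 mulVf.
  by rewrite mulr1 divfK // subrr mulr0.
have jNk : (j == k) = false by rewrite -[_ == _]/(val j == val k) ltn_eqF.
rewrite (gcol i j jk) (gcol k j jk) (eq_sym k j) jNk mulr0 subr0.
by have [->|_] := eqVneq i j; rewrite ?mulr0 // jNk invr1 mulr1.
Qed.

End Generation.

Lemma unitmx_gen_ind (K : fieldType) (n : nat) (P : 'M[K]_n -> Prop) :
  (forall g h, g \in unitmx -> h \in unitmx -> P g -> P h -> P (g *m h)) ->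
  (forall a b t, a != b -> P (1%:M + t *: delta_mx a b)) ->
  (forall d : 'rV[K]_n, (forall i, d 0 i != 0) -> P (diag_mx d)) ->
  forall g, g \in unitmx -> P g.
Proof.
move=> PM Pt Pd.
(* Here m counts the columns still to be cleared. *)
suff Pk m : (m <= n)%N -> forall g, g \in unitmx ->
    (forall i j : 'I_n, (j < n - m)%N -> g i j = (i == j)%:R) -> P g.
  by move=> g gu; apply: (Pk n) => // i j; rewrite subnn.
elim: m => [_ g _ g1|m IHm mn g gu gcol].
  have -> : g = diag_mx (const_mx 1).
    by apply/matrixP => i j; rewrite g1 ?subn0 // !mxE mulrb.
  by apply: Pd => i; rewrite mxE oner_eq0.
have km : (n - m.+1 < n)%N by rewrite ltn_subrL (leq_trans _ mn).
pose k := Ordinal km; have kS : (n - m)%N = k.+1 by rewrite /= subnSK.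
have Ph h : h \in unitmx ->
    (forall i j : 'I_n, (j <= k)%N -> h i j = (i == j)%:R) -> P h.
  by move=> hu hcol; apply: IHm => [|//|i j]; [apply: ltnW | rewrite kS; apply: hcol].
have [gk|gk] := eqVneq (g k k) 0; last exact: (clear_column PM Pt Pd gu gk gcol Ph).
have [i ki gi] : exists2 i : 'I_n, (k < i)%N & g i k != 0.
  apply/exists_inP; apply: contraT => /exists_inPn gk0.
  (* Otherwise column k is a combination of the preceding ones. *)
  pose w : 'cV[K]_n := \col_i (if (i < k)%N then - g i k else (i == k)%:R).
  have gw : g *m w = 0.
    apply/colP => i; rewrite mxE (bigID (fun j : 'I_n => (j < k)%N)) /=.
    rewrite (eq_bigr (fun j : 'I_n => - ((i == j)%:R * g j k))) => [|j jk]; last first.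
      by rewrite (gcol i j jk) mxE jk mulrN.
    rewrite [X in _ + X](bigD1 k) ?ltnn //= [X in _ + (_ + X)]big1 => [|j /andP[jk jk']].
      rewrite mxE ltnn eqxx mulr1 addr0 mxE sumrN.
      have [ik|ki] := ltnP i k.
        rewrite (bigD1 i) //= eqxx mul1r big1 ?addr0 ?addNr // => j /andP[_ ji].
        by rewrite eq_sym (negPf ji) mul0r.
      rewrite big1 => [|j jk]; last first.
        by rewrite eq_sym -[_ == _]/(val j == val i) ltn_eqF ?mul0r // (leq_trans jk).
      rewrite oppr0 add0r; move: ki; rewrite leq_eqVlt => /predU1P[/val_inj<- //|].
      by move/gk0; rewrite negbK => /eqP.
    by rewrite mxE (negPf jk) (negPf jk') mulr0.
  have : w = 0 by rewrite -(mulKmx gu w) gw mulmx0.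
  by move/colP/(_ k); rewrite !mxE ltnn eqxx => /eqP; rewrite oner_eq0.
have kNi : k != i by rewrite -[_ == _]/(val k == val i) ltn_eqF.
(* The pivot is zero, so row i is added to row k. As i > k, this leaves the columns already cleared
   unchanged. *)
pose T t : 'M[K]_n := 1%:M + t *: delta_mx k i.
have TT : T (- 1) *m T 1 = 1%:M.
  rewrite /T mulmxDl !mulmxDr !mul1mx mulmx1 -scalemxAl -scalemxAr.
  rewrite mul_delta_mx_0 1?eq_sym // !scaler0 addr0 -addrA -scalerDl.
  by rewrite addrN scale0r addr0.
have [T1 T2] := mulmx1_unit TT.
have -> : g = T (- 1) *m (T 1 *m g) by rewrite mulmxA TT mul1mx.
have rowT l j : (T 1 *m g) l j = g l j + (l == k)%:R * g i j.
  rewrite /T scale1r mulmxDl mul1mx mxE; congr (_ + _).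
  rewrite mxE (bigD1 i) //= big1 ?addr0 => [|r ri]; first by rewrite mxE eqxx andbT.
  by rewrite mxE (negPf ri) andbF mul0r.
apply: (PM); rewrite ?unitmx_mul ?T2 //; first exact: (Pt).
apply: (@clear_column _ _ P PM Pt Pd k) => //; first by rewrite unitmx_mul T2.
  by rewrite rowT gk eqxx mul1r add0r.
move=> l j jk; rewrite rowT (gcol l j jk) (gcol i j jk) (eq_sym i j).
rewrite -[j == i]/(val j == val i).
by rewrite ltn_eqF ?mulr0 ?addr0 // (ltn_trans jk).
Qed.

(** * Tensor of third derivatives *)

Section Tens.
Variables (K : numFieldType) (n : nat).
Implicit Types (A B C X : 'M[K]_n) (p q : S3gl K n) (x y z : 'I_n * 'I_n).

Definition ivar x := mxvec_index x.1 x.2.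

(** In degree 3 the third derivatives are constants, hence the coefficient at 0. *)
Definition tens x y z p : K :=
  (mderiv (ivar z) (mderiv (ivar y) (mderiv (ivar x) (mpoly_of_dhomog p))))@_0.

Fact tens_linear x y z : scalar (tens x y z).
Proof. by move=> a p q; rewrite /tens linearP /= !(linearP, mcoeffD, mcoeffZ). Qed.
HB.instance Definition _ x y z :=
  GRing.isLinear.Build K _ _ _ (tens x y z) (tens_linear x y z).

Lemma tensC x y z p : tens x y z p = tens y x z p.
Proof. by rewrite /tens (mderiv_comm (ivar x) (ivar y)). Qed.

Lemma tensAC x y z p : tens x y z p = tens x z y p.
Proof. by rewrite /tens mderiv_comm. Qed.

Definition ent A x := A x.1 x.2.

Lemma tens_prod3 A B C x y z : tens x y z (prod3 A B C) =
    ent A x * ent B y * ent C z + ent A x * ent B z * ent C y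
  + ent A y * ent B x * ent C z + ent A y * ent B z * ent C x
  + ent A z * ent B x * ent C y + ent A z * ent B y * ent C x.
Proof.
rewrite /tens val_prod3 /ivar /ent.
rewrite !(mderivM, mderivD, mderiv_gl_var, mderivC, mul0r, mulr0, addr0, add0r).
rewrite -!(mpolyCM, mpolyCD) mcoeffC eqxx mulr1.
by ring.
Qed.

Lemma mnm_rev3 (N : nat) (a b c : 'X_{1..N}) : (a + b + c = c + b + a)%MM.
Proof. by rewrite addmC [X in (c + X)%MM]addmC addmA. Qed.

(** Each entry is a coefficient of p times a positive integer, which is invertible in characteristic
    0. *)
Lemma tens_eq0 p : (forall x y z, tens x y z p = 0) -> p = 0.
Proof.
move=> p0; apply: val_inj; apply/mpolyP => m; rewrite [RHS]mcoeff0.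
have [m3|m3] := eqVneq (mdeg m) 3%N; last first.
  exact: (dhomog_nemf_coeff (dhomog_is_dhomog p)).
have [a [b [c em]]] := mnm_deg3 m3.
case/mxvec_indexP: a em => a1 a2; case/mxvec_indexP: b => b1 b2.
case/mxvec_indexP: c => c1 c2 em.
have := p0 (a1, a2) (b1, b2) (c1, c2).
rewrite /tens !mcoeff_mderiv /ivar /= add0m.
rewrite mnm_rev3 -em => /eqP; rewrite !mulrn_eq0 /=.
by move/eqP.
Qed.

Lemma tens_neq0 p m : m \in msupp (mpoly_of_dhomog p) ->
  exists x y z, m = (U_(ivar x) + U_(ivar y) + U_(ivar z))%MM /\ tens x y z p != 0.
Proof.
move=> mp; have m3 := dhomog_mf (dhomog_is_dhomog p) mp.
have [a [b [c em]]] := mnm_deg3 m3.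
case/mxvec_indexP: a em => a1 a2; case/mxvec_indexP: b => b1 b2.
case/mxvec_indexP: c => c1 c2 em.
exists (a1, a2), (b1, b2), (c1, c2); split=> //.
rewrite /tens !mcoeff_mderiv /ivar /= add0m.
by rewrite mnm_rev3 -em !mulrn_eq0 /= -mcoeff_msupp.
Qed.

Lemma tens_msupp p x y z : tens x y z p != 0 ->
  (U_(ivar x) + U_(ivar y) + U_(ivar z))%MM \in msupp (mpoly_of_dhomog p).
Proof.
rewrite /tens !mcoeff_mderiv add0m.
by rewrite mnm_rev3 !mulrn_eq0 /= -mcoeff_msupp.
Qed.

(* The action of E_{a,b} on one slot of a tensor. *)
Definition eact (a b : 'I_n) (f : 'I_n * 'I_n -> K) x :=
  (x.1 == a)%:R * f (b, x.2) - (x.2 == b)%:R * f (x.1, a).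

Lemma ent_ad a b A x :
  ent (delta_mx a b *m A - A *m delta_mx a b) x = eact a b (ent A) x.
Proof.
rewrite /ent /eact !mxE; congr (_ - _).
  rewrite (bigD1 b) //= big1 ?addr0 => [|j jb]; first by rewrite mxE eqxx andbT.
  by rewrite mxE (negPf jb) andbF mul0r.
rewrite (bigD1 a) //= big1 ?addr0 => [|j ja]; first by rewrite mxE eqxx mulrC.
by rewrite mxE (negPf ja) mulr0.
Qed.

(** On a product of three matrices the Leibniz rule applies the bracket to one factor, hence to one
    slot, at a time. *)
Lemma tens_glact a b p x y z :
  tens x y z (glact (delta_mx a b) p) =
    eact a b (fun x => tens x y z p) x + eact a b (fun y => tens x y z p) y
  + eact a b (fun z => tens x y z p) z.
Proof.
elim/S3gl_ind: p => [c p q IHp IHq|A B C].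
  rewrite glact_linear tens_linear IHp IHq.
  have eactP f g h x' : (forall u, h u = c * f u + g u) ->
      eact a b h x' = c * eact a b f x' + eact a b g x'.
    by move=> hE; rewrite /eact !hE; ring.
  rewrite (eactP _ _ _ x (fun u => tens_linear u y z c p q)).
  rewrite (eactP _ _ _ y (fun u => tens_linear x u z c p q)).
  rewrite (eactP _ _ _ z (fun u => tens_linear x y u c p q)).
  by rewrite !mulrDr addrACA [X in X + _]addrACA.
rewrite glact_prod3 2!(linearD (tens x y z)) /=.
by rewrite !tens_prod3 !ent_ad /eact !tens_prod3; ring.
Qed.

Lemma invmx_uniq (A B : 'M[K]_n) : A *m B = 1%:M -> invmx A = B.
Proof.
move=> AB; have [Au _] := mulmx1_unit AB.
by rewrite -[LHS]mulmx1 -AB mulKmx.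
Qed.

Lemma diag_mxV (d : 'rV[K]_n) : (forall i, d 0 i != 0) ->
  invmx (diag_mx d) = diag_mx (\row_i (d 0 i)^-1).
Proof.
move=> d0; apply: invmx_uniq; apply/matrixP => i j.
rewrite mul_mx_diag !mxE; have [->|_] := eqVneq i j.
  by rewrite mulr1n divff.
by rewrite mulr0n mul0r.
Qed.

Lemma ent_diag_conj (d : 'rV[K]_n) A x : (forall i, d 0 i != 0) ->
  ent (diag_mx d *m A *m invmx (diag_mx d)) x = d 0 x.1 / d 0 x.2 * ent A x.
Proof.
by move=> d0; rewrite diag_mxV // /ent mul_mx_diag mul_diag_mx !mxE mulrAC.
Qed.

Lemma tens_GLact_diag (d : 'rV[K]_n) p x y z : (forall i, d 0 i != 0) ->
  tens x y z (GLact (diag_mx d) p) =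
  (d 0 x.1 / d 0 x.2) * (d 0 y.1 / d 0 y.2) * (d 0 z.1 / d 0 z.2) * tens x y z p.
Proof.
move=> d0; elim/S3gl_ind: p => [c p q IHp IHq|A B C].
  by rewrite !linearP /= IHp IHq /=; ring.
by rewrite GLact_prod3 !tens_prod3 !ent_diag_conj //; ring.
Qed.

Definition wt x : 'rV[int]_n := delta_mx 0 x.1 - delta_mx 0 x.2.

Lemma mnm_weightD (m m' : 'X_{1..n * n}) :
  mnm_weight (m + m')%MM = mnm_weight m + mnm_weight m'.
Proof.
rewrite /mnm_weight -big_split; apply: eq_bigr => i _.
rewrite -big_split; apply: eq_bigr => j _ /=.
by rewrite mnmDE mulrnDr.
Qed.

Lemma mxvec_index_inj (i j k l : 'I_n) :
  (mxvec_index i j == mxvec_index k l) = (i == k) && (j == l).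
Proof.
apply/eqP/andP => [|[/eqP-> /eqP->] //].
move/(congr1 (fun k => (vec_mx (delta_mx 0 k) : 'M[K]_n))).
rewrite !vec_mx_delta => /matrixP/(_ i j); rewrite !mxE !eqxx /=.
by case: andP => // _ /eqP; rewrite oner_eq0.
Qed.

Lemma mnm_weight1 x : mnm_weight U_(ivar x)%MM = wt x.
Proof.
rewrite /mnm_weight (bigD1 x.1) //= (bigD1 x.2) //= mnmE eqxx mulr1n.
rewrite big1 ?addr0 => [|j jx]; last first.
  by rewrite mnmE mxvec_index_inj eqxx eq_sym (negPf jx) mulr0n.
rewrite big1 ?addr0 // => i ix; apply: big1 => j _.
by rewrite mnmE mxvec_index_inj eq_sym (negPf ix) mulr0n.
Qed.

Lemma has_weightP lam p :
  has_weight lam p <->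
  (forall x y z, tens x y z p != 0 -> wt x + wt y + wt z = lam).
Proof.
split=> [plam x y z /tens_msupp /plam <-|plam m].
  by rewrite !mnm_weightD !mnm_weight1.
by case/tens_neq0 => x [y [z [-> /plam <-]]]; rewrite !mnm_weightD !mnm_weight1.
Qed.

Lemma eact_diag a (f : 'I_n * 'I_n -> K) x :
  eact a a f x = (wt x 0 a)%:~R * f x.
Proof.
case: x => i j; rewrite /eact !mxE /= [i == a]eq_sym [j == a]eq_sym.
rewrite rmorphB /= mulrBl !natz -!pmulrn; congr (_ - _).
  by have [->|_] := eqVneq a i; rewrite ?mul0r.
by have [->|_] := eqVneq a j; rewrite ?mul0r.
Qed.

Lemma glact_weight lam p a : has_weight lam p ->
  glact (delta_mx a a) p = (lam 0 a)%:~R *: p.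
Proof.
move/has_weightP => plam; apply/eqP; rewrite -subr_eq0; apply/eqP.
apply: tens_eq0 => x y z; rewrite linearB linearZ /= tens_glact !eact_diag.
have [->|/plam <-] := eqVneq (tens x y z p) 0; first by rewrite !mulr0 !addr0 subr0.
by rewrite !mxE !rmorphD /= -/(wt _ _ _); ring.
Qed.

Lemma GLact_weight lam p (d : 'rV[K]_n) : has_weight lam p ->
  (forall i, d 0 i != 0) -> exists c, GLact (diag_mx d) p = c *: p.
Proof.
move=> /has_weightP plam d0.
(* The character of the diagonal torus with weight mu, evaluated at d. *)
pose chi (mu : 'rV[int]_n) := \prod_k d 0 k ^ mu 0 k.
have chiD mu nu : chi (mu + nu) = chi mu * chi nu.
  rewrite -big_split; apply: eq_bigr => k _ /=.
  by rewrite mxE expfzDr.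
have chi1 x : chi (wt x) = d 0 x.1 / d 0 x.2.
  have chie i (e : int) : chi (e *: delta_mx 0 i) = d 0 i ^ e.
    rewrite /chi (bigD1 i) //= big1 => [|j ji]; first by rewrite !mxE !eqxx !mulr1.
    by rewrite !mxE (negPf ji) andbF mulr0.
  by rewrite /wt -[X in X - _]scale1r -scaleN1r chiD !chie.
exists (chi lam); apply/eqP; rewrite -subr_eq0; apply/eqP.
apply: tens_eq0 => x y z; rewrite linearB linearZ /= tens_GLact_diag //.
have [->|/plam <-] := eqVneq (tens x y z p) 0; first by rewrite !mulr0 subr0.
by rewrite (chiD (wt x + wt y)) (chiD (wt x)) !chi1; ring.
Qed.

End Tens.

(** * Brackets, composition and equivariance for the two actions *)

Section Actions.
Variables (K : numFieldType) (n : nat).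
Implicit Types (A B C X Y g h : 'M[K]_n) (p q : S3gl K n).

Lemma glact_linX a X Y p : glact (a *: X + Y) p = a *: glact X p + glact Y p.
Proof.
elim/S3gl_ind: p => [c p q IHp IHq|A B C].
  rewrite !linearP /= IHp IHq. rewrite !scalerDr !scalerA mulrC; exact: addrACA.
have ad Z : (a *: X + Y) *m Z - Z *m (a *: X + Y)
    = a *: (X *m Z - Z *m X) + (Y *m Z - Z *m Y).
  by rewrite mulmxDl mulmxDr -scalemxAl -scalemxAr scalerBr opprD addrACA.
rewrite !glact_prod3 !ad; apply: val_inj.
by rewrite /= !linearP /= -!mul_mpolyC; ring.
Qed.

Lemma glact0l p : glact 0 p = 0.
Proof. by have := glact_linX (- 1) 0 0 p; rewrite scaler0 addr0 scaleN1r addNr. Qed.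

Lemma glactZl a X p : glact (a *: X) p = a *: glact X p.
Proof. by have := glact_linX a X 0 p; rewrite glact0l !addr0. Qed.

Lemma glactBl X Y p : glact (X - Y) p = glact X p - glact Y p.
Proof. by rewrite addrC -scaleN1r glact_linX scaleN1r addrC. Qed.

Lemma glact_bracket X Y p :
  glact X (glact Y p) = glact Y (glact X p) + glact (X *m Y - Y *m X) p.
Proof.
elim/S3gl_ind: p => [c p q IHp IHq|A B C].
  by rewrite !linearP /= IHp IHq scalerDr addrACA.
pose D (Z M : 'M[K]_n) : 'M[K]_n := Z *m M - M *m Z.
have gl Z L M N : glact Z (prod3 L M N) =
    prod3 (D Z L) M N + prod3 L (D Z M) N + prod3 L M (D Z N) by exact: glact_prod3.
(* The Jacobi identity. Once D is opaque, only a commutative ring identity is left. *)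
have DD M : D (X *m Y - Y *m X) M = D X (D Y M) - D Y (D X M).
  rewrite /D !(mulmxBl, mulmxBr) !mulmxA.
  move: (X *m Y *m M) (Y *m X *m M) (M *m X *m Y) (M *m Y *m X)
    (X *m M *m Y) (Y *m M *m X) => a b c d e f.
  by apply/matrixP => i j; rewrite !mxE; ring.
move: (X *m Y - Y *m X) DD => Z DD; clearbody D.
rewrite !gl !(linearD (glact X)) !(linearD (glact Y)) /= !gl !DD; apply: S3gl_eq.
by rewrite !(val_S3glD, val_prod3, gl_varB); ring.
Qed.

Lemma GLact_mul g h p : g \in unitmx -> h \in unitmx ->
  GLact g (GLact h p) = GLact (g *m h) p.
Proof.
move=> gu hu; elim/S3gl_ind: p => [c p q IHp IHq|A B C].
  by rewrite !linearP /= IHp IHq.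
have invM : invmx (g *m h) = invmx h *m invmx g.
  by apply: invmx_uniq; rewrite mulmxA mulmxK ?mulmxV.
by rewrite !GLact_prod3 invM !mulmxA.
Qed.

Lemma GLact_glact g X p : g \in unitmx ->
  GLact g (glact X p) = glact (g *m X *m invmx g) (GLact g p).
Proof.
move=> gu; elim/S3gl_ind: p => [c p q IHp IHq|A B C].
  by rewrite !linearP /= IHp IHq.
have ad Z : g *m (X *m Z - Z *m X) *m invmx g =
   (g *m X *m invmx g) *m (g *m Z *m invmx g)
   - (g *m Z *m invmx g) *m (g *m X *m invmx g).
  by rewrite mulmxBr mulmxBl !mulmxA !mulmxKV.
rewrite GLact_prod3 !glact_prod3 -!ad.
by rewrite 2!(linearD (GLact g)) /= !GLact_prod3.
Qed.

End Actions.

(** * Transvections *)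

Section Transvections.
Variables (K : numFieldType) (n : nat).
Implicit Types (A B C X Y g h : 'M[K]_n) (p q : S3gl K n).

Definition transv (a b : 'I_n) (t : K) : 'M[K]_n := 1%:M + t *: delta_mx a b.

Lemma transvV a b t : a != b -> transv a b t *m transv a b (- t) = 1%:M.
Proof.
move=> ab; rewrite /transv mulmxDl !mulmxDr !mul1mx mulmx1 scaleNr.
rewrite -scaleNr -scalemxAl -scalemxAr mul_delta_mx_0 1?eq_sym //.
by rewrite !scaler0 addr0 -addrA -scalerDl addNr scale0r addr0.
Qed.

Lemma transv_unit a b t : a != b -> transv a b t \in unitmx.
Proof. by move/(transvV t)/mulmx1_unit => -[]. Qed.

(* The one-parameter group of a transvection is the exponential of its
   generator, so c k plays the role of X^k p / k!. *)
Lemma GLact_transv a b p : a != b -> exists c : nat -> S3gl K n,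
  [/\ c 0%N = p,
      forall k, glact (delta_mx a b) (c k) = k.+1%:R *: c k.+1
    & forall t, GLact (transv a b t) p = \sum_(k < 7) t ^+ k *: c k].
Proof.
move=> ab; elim/S3gl_ind: p => [s p q [c [c0 cS ct]] [d [d0 dS dt]]|A B C].
  exists (fun k => s *: c k + d k); split=> [|k|t]; first by rewrite c0 d0.
    by rewrite linearP /= cS dS scalerDr !scalerA mulrC.
  rewrite linearP /= ct dt scaler_sumr -big_split; apply: eq_bigr => k _ /=.
  by rewrite scalerDr !scalerA mulrC.
pose valE := (val_S3glD, val_S3glZ, val_prod3, gl_varD, gl_varZ).
pose X := delta_mx a b : 'M[K]_n.
have XX : X *m X = 0 by rewrite mul_delta_mx_0 1?eq_sym.
(* As X squares to 0, conjugation by 1 + t X sends M to M + t D M + t^2 S M. Moreover D (D M) = 2 S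
   M and D (S M) = 0. *)
pose D M := X *m M - M *m X; pose S M := - (X *m M *m X).
have DD M : X *m D M - D M *m X = 2%:R *: S M.
  rewrite /D /S mulmxBr mulmxBl !mulmxA XX mul0mx -[M *m X *m X]mulmxA XX.
  by rewrite mulmx0 subr0 sub0r scaler_nat mulr2n.
have DS M : X *m S M - S M *m X = 0.
  by rewrite /S mulmxN mulNmx !mulmxA XX !mul0mx -[X *m M *m X *m X]mulmxA XX mulmx0 subrr.
have conjX t M : transv a b t *m M *m invmx (transv a b t)
    = M + t *: D M + t ^+ 2 *: S M.
  rewrite (invmx_uniq (transvV t ab)) /transv mulmxDl mul1mx mulmxDr mulmx1.
  rewrite mulmxDl scaleNr mulmxN mulmxN /D /S -!scalemxAl -!scalemxAr -/X.
  rewrite scalerA; move: (X *m M) (M *m X) (X *m M *m X) => u v w.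
  by apply/matrixP => i j; rewrite !mxE; ring.
have gl L M N : glact X (prod3 L M N) =
    prod3 (D L) M N + prod3 L (D M) N + prod3 L M (D N) by rewrite glact_prod3.
have DDE M : D (D M) = 2%:R *: S M by exact: DD.
have DSE M : D (S M) = 0 by exact: DS.
clear DD DS; clearbody D S.
(* The coefficients of t^0, ..., t^6 in a product of three quadratic polynomials in t, and 0
   beyond. *)
exists (fun k => nth 0 [:: prod3 A B C;
  prod3 (D A) B C + prod3 A (D B) C + prod3 A B (D C);
  prod3 (S A) B C + prod3 A (S B) C + prod3 A B (S C)
    + prod3 (D A) (D B) C + prod3 (D A) B (D C) + prod3 A (D B) (D C);
  prod3 (D A) (D B) (D C) + prod3 (S A) (D B) C + prod3 (S A) B (D C)
    + prod3 (D A) (S B) C + prod3 A (S B) (D C)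
    + prod3 (D A) B (S C) + prod3 A (D B) (S C);
  prod3 (S A) (S B) C + prod3 (S A) B (S C) + prod3 A (S B) (S C)
    + prod3 (S A) (D B) (D C) + prod3 (D A) (S B) (D C) + prod3 (D A) (D B) (S C);
  prod3 (S A) (S B) (D C) + prod3 (S A) (D B) (S C) + prod3 (D A) (S B) (S C);
  prod3 (S A) (S B) (S C)] k).
split=> // [k|t]; last first.
  rewrite GLact_prod3 !conjX !big_ord_recl big_ord0 addr0 expr0 scale1r.
  rewrite /bump /= expr1; apply: S3gl_eq; rewrite !valE !rmorphXn /=.
  by ring.
have [k7|k7] := leqP 7 k.
  by rewrite !nth_default ?scaler0 ?linear0 // ltnW.
rewrite -/X; case: k k7 => [|[|[|[|[|[|[|k]]]]]]] // _.
all: rewrite /= ?(linearD (glact X)) /= ?gl ?DDE ?DSE; apply: S3gl_eq.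
all: rewrite ?valE ?linear0 ?rmorph_nat.
all: ring.
Qed.

(* Comparing [f (2 t)] with [2 ^ N f t] kills the leading coefficient. *)
Lemma poly_coef_mem (V : vectType K) (U : {vspace V}) N (c : nat -> V) :
  (forall t : K, \sum_(k < N) t ^+ k *: c k \in U) ->
  forall k, (k < N)%N -> c k \in U.
Proof.
elim: N c => // N IHN c cU.
have lowU k : (k < N)%N -> c k \in U.
  move=> kN; have nz : (2%:R ^+ k - 2%:R ^+ N : K) != 0.
    by rewrite subr_eq0 -!natrX eqr_nat eqn_exp2l // neq_ltn kN.
  suff: (2%:R ^+ k - 2%:R ^+ N) *: c k \in U by rewrite rpredZeq (negPf nz).
  suff h t : \sum_(i < N) t ^+ i *: ((2%:R ^+ i - 2%:R ^+ N) *: c i) \in U.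
    exact: (IHN (fun i => (2%:R ^+ i - 2%:R ^+ N) *: c i)).
  have := memvB (cU (2%:R * t)) (memvZ (2%:R ^+ N) (cU t)).
  rewrite !big_ord_recr /= scalerDr opprD addrACA scalerA -exprMn subrr addr0.
  rewrite scaler_sumr -sumrB.
  rewrite (eq_bigr (fun i : 'I_N => t ^+ i *: ((2%:R ^+ i - 2%:R ^+ N) *: c i))) //.
  by move=> i _; rewrite !scalerA -scalerBl exprMn -mulrBl mulrC.
move=> k; rewrite ltnS leq_eqVlt => /orP[/eqP->|/lowU //].
have := cU 1; rewrite big_ord_recr /= expr1n scale1r rpredDl //.
by apply: rpred_sum => i _; rewrite memvZ ?lowU.
Qed.

(** A subspace containing all the values of a polynomial curve contains its coefficients. The
    coefficient of t in t |-> (1 + t E_{a,b}) p is the image of p under E_{a,b}. *)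
Lemma GLstable_glact (U : {vspace S3gl K n}) a b p : a != b ->
  GLstable U -> p \in U -> glact (delta_mx a b) p \in U.
Proof.
move=> ab stU pU; have [c [c0 cS ct]] := GLact_transv p ab.
rewrite -c0 cS; apply: memvZ; apply: (poly_coef_mem (N := 7)) => // t.
by rewrite -ct; apply: stU => //; apply: transv_unit.
Qed.

(** Conversely, E_{a,b} sends each coefficient of the curve to a nonzero multiple of the next, so
    all of them lie in U. *)
Lemma glact_GLact_transv (U : {vspace S3gl K n}) a b t p : a != b ->
  {in U, forall q, glact (delta_mx a b) q \in U} -> p \in U ->
  GLact (transv a b t) p \in U.
Proof.
move=> ab stU pU; have [c [c0 cS ->]] := GLact_transv p ab.
suff cU k : c k \in U by apply: memv_suml => k _; apply: memvZ.
elim: k => [|k IHk]; first by rewrite c0.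
by have := stU _ IHk; rewrite cS rpredZeq pnatr_eq0.
Qed.

End Transvections.

Section Generation.
Variables (K : fieldType) (n : nat) (P : 'M[K]_n -> Prop).
Hypothesis P1 : P 1%:M.
Hypothesis PM : forall g h, g \in unitmx -> h \in unitmx -> P g -> P h -> P (g *m h).
Hypothesis Pt : forall a b t, a != b -> P (1%:M + t *: delta_mx a b).
Hypothesis Pd : forall d : 'rV[K]_n, (forall i, d 0 i != 0) -> P (diag_mx d).

End Generation.

(** * Invariant Hermitian form *)

(** A subspace inside P can be enlarged as long as it misses a vector of P, and its dimension is
    bounded. This turns an inductively generated submodule into a vector space. *)
Lemma vspace_of_pred (K : fieldType) (V : vectType K) (P : V -> Prop) :
  P 0 -> (forall a u v, P u -> P v -> P (a *: u + v)) ->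
  exists W : {vspace V}, forall v, v \in W <-> P v.
Proof.
move=> P0 PD.
suff main k (U : {vspace V}) : (\dim {:V} - \dim U <= k)%N ->
    (forall v, v \in U -> P v) -> exists W : {vspace V}, forall v, v \in W <-> P v.
  apply: (main (\dim {:V}) 0%VS); first exact: leq_subr.
  by move=> v; rewrite memv0 => /eqP->.
elim: k U => [|k IHk] U dU UP.
  exists U => v; split=> [/UP //|_].
  have -> : U = fullv by apply/eqP; rewrite eqEdim subvf -subn_eq0 -leqn0.
  exact: memvf.
have [[v [Pv vU]]|noV] := EM (exists v, P v /\ v \notin U); last first.
  exists U => v; split=> [/UP //|Pv].
  by apply: contraT => vU; case: noV; exists v.
apply: (IHk (<[v]> + U)%VS) => [|w].
  have lt_dim : (\dim U < \dim (<[v]> + U))%N.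
    rewrite ltn_neqAle dimvS ?addvSr // andbT; apply: contra vU => /eqP dE.
    have -> : U = (<[v]> + U)%VS by apply/eqP; rewrite eqEdim addvSr dE /=.
    by rewrite (subvP (addvSl _ _)) ?memv_line.
  by rewrite leq_subLR (leq_trans _ (leq_add lt_dim (leqnn k))) // addSnnS -leq_subLR.
by case/memv_addP => _ /vlineP[c ->] [u /UP Pu ->]; apply: PD.
Qed.

Section Form.
Variables (K : numClosedFieldType) (n : nat).
Implicit Types (p q d v : S3gl K n) (U W : {vspace S3gl K n}).

Definition tform p q : K :=
  \sum_x \sum_y \sum_z tens x y z p * (tens x y z q)^*.

Lemma tform_linearl q : scalar (tform ^~ q).
Proof.
move=> a u v; rewrite /tform mulr_sumr -big_split; apply: eq_bigr => x _.
rewrite mulr_sumr -big_split; apply: eq_bigr => y _.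
rewrite mulr_sumr -big_split; apply: eq_bigr => z _ /=.
by rewrite linearP /= mulrDl mulrA.
Qed.

Lemma tformC p q : tform q p = (tform p q)^*.
Proof.
rewrite /tform rmorph_sum; apply: eq_bigr => x _.
rewrite rmorph_sum; apply: eq_bigr => y _.
rewrite rmorph_sum; apply: eq_bigr => z _ /=.
by rewrite rmorphM /= conjCK mulrC.
Qed.

Lemma tform_eq0 p : tform p p = 0 -> p = 0.
Proof.
have ge0 x y z : 0 <= tens x y z p * (tens x y z p)^* by apply: mul_conjC_ge0.
move=> p0; apply: tens_eq0 => x y z; apply/eqP; rewrite -mul_conjC_eq0.
have /psumr_eq0P/(_ p0 x isT) : forall x, true ->
    0 <= \sum_y \sum_z tens x y z p * (tens x y z p)^*.
  by move=> x' _; do 2!apply: sumr_ge0 => ? _.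
move/psumr_eq0P => /(_ (fun _ _ => sumr_ge0 _ (fun _ _ => ge0 _ _ _)) y isT).
by move/psumr_eq0P => /(_ (fun _ _ => ge0 _ _ _) z isT) ->.
Qed.

(** Each term of [eact] fixes one row or one column, and both sides collapse to the same sums over
    the free index. *)
Lemma eact_adj a b (f g : 'I_n * 'I_n -> K) :
  \sum_x eact a b f x * (g x)^* = \sum_x f x * (eact b a g x)^*.
Proof.
have pick1 c (G : 'I_n * 'I_n -> K) :
    \sum_x (x.1 == c)%:R * G x = \sum_j G (c, j).
  rewrite (eq_bigr (fun x => (x.1 == c)%:R * G (x.1, x.2))) => [|[] //].
  rewrite -(pair_bigA _ (fun i j => (i == c)%:R * G (i, j))) (bigD1 c) //=.
  rewrite [X in _ + X]big1 ?addr0 => [|i ic]; last first.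
    by rewrite (negPf ic) big1 // => j _; rewrite mul0r.
  by apply: eq_bigr => j _; rewrite eqxx mul1r.
have pick2 c (G : 'I_n * 'I_n -> K) :
    \sum_x (x.2 == c)%:R * G x = \sum_i G (i, c).
  rewrite (eq_bigr (fun x => (x.2 == c)%:R * G (x.1, x.2))) => [|[] //].
  rewrite -(pair_bigA _ (fun i j => (j == c)%:R * G (i, j))).
  apply: eq_bigr => i _; rewrite (bigD1 c) //= eqxx mul1r.
  by rewrite [X in _ + X]big1 ?addr0 // => j jc; rewrite (negPf jc) mul0r.
under eq_bigr do rewrite mulrBl -!mulrA.
under [RHS]eq_bigr do rewrite rmorphB !rmorphM !rmorph_nat mulrBr !(mulrCA (f _)).
by rewrite !sumrB !pick1 !pick2.
Qed.

Lemma tform_glact a b p q :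
  tform (glact (delta_mx a b) p) q = tform p (glact (delta_mx b a) q).
Proof.
have exch (F : 'I_n * 'I_n -> 'I_n * 'I_n -> 'I_n * 'I_n -> K) :
    \sum_x \sum_y \sum_z F x y z = \sum_y \sum_z \sum_x F x y z.
  by rewrite exchange_big; apply: eq_bigr => y _; rewrite exchange_big.
(* The sum over the slot acted upon is moved innermost, where [eact_adj] applies. *)
transitivity
  (\sum_y \sum_z \sum_x eact a b (fun x => tens x y z p) x * (tens x y z q)^*
   + \sum_x \sum_z \sum_y eact a b (fun y => tens x y z p) y * (tens x y z q)^*
   + \sum_x \sum_y \sum_z eact a b (fun z => tens x y z p) z * (tens x y z q)^*).
  rewrite -exch -2!big_split; apply: eq_bigr => x _ /=.
  rewrite [X in _ + X + _]exchange_big -2!big_split; apply: eq_bigr => y _ /=.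
  rewrite -2!big_split; apply: eq_bigr => z _ /=.
  by rewrite tens_glact !mulrDl.
transitivity
  (\sum_y \sum_z \sum_x tens x y z p * (eact b a (fun x => tens x y z q) x)^*
   + \sum_x \sum_z \sum_y tens x y z p * (eact b a (fun y => tens x y z q) y)^*
   + \sum_x \sum_y \sum_z tens x y z p * (eact b a (fun z => tens x y z q) z)^*).
  congr (_ + _ + _); apply: eq_bigr => ? _; apply: eq_bigr => ? _; exact: eact_adj.
rewrite -exch -2!big_split; apply: eq_bigr => x _ /=.
rewrite [X in _ + X + _]exchange_big -2!big_split; apply: eq_bigr => y _ /=.
rewrite -2!big_split; apply: eq_bigr => z _ /=.
by rewrite tens_glact !rmorphD /= !mulrDr.
Qed.

Definition tform_with q p := tform p q.
HB.instance Definition _ q :=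
  GRing.isLinear.Build K _ _ _ (tform_with q) (tform_linearl q).

Lemma tform0r p : tform p 0 = 0.
Proof. by rewrite tformC -[tform 0 p]/(tform_with p 0) linear0 conjC0. Qed.

Lemma tformPr p a q r : tform p (a *: q + r) = a^* * tform p q + tform p r.
Proof.
rewrite tformC -[tform _ p]/(tform_with p _) linearP rmorphD rmorphM /=.
by rewrite -!tformC.
Qed.

Lemma tform_suml I (r : seq I) (P : pred I) (F : I -> S3gl K n) q :
  tform (\sum_(i <- r | P i) F i) q = \sum_(i <- r | P i) tform (F i) q.
Proof. exact: (linear_sum (tform_with q)). Qed.

(** The form is definite, so the Gram matrix of a basis of U is invertible and gives the coordinates
    of the projection h. *)
Lemma orth_proj U p :
  exists2 h, h \in U & forall u, u \in U -> tform (p - h) u = 0.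
Proof.
pose m := \dim U; pose b := vbasis U.
pose G : 'M[K]_m := \matrix_(i, j) tform b`_i b`_j.
have comb (c : 'rV[K]_m) j : (c *m G) 0 j = tform (\sum_i c 0 i *: b`_i) b`_j.
  rewrite tform_suml mxE; apply: eq_bigr => i _; rewrite mxE.
  by rewrite -[tform (_ *: _) _]/(tform_with _ _) linearZ.
have bU (c : 'rV[K]_m) : \sum_i c 0 i *: b`_i \in U.
  apply: memv_suml => i _; apply: memvZ; apply: vbasis_mem.
  by apply: mem_nth; rewrite size_tuple.
have orthb d : (forall j : 'I_m, tform d b`_j = 0) -> forall u, u \in U -> tform d u = 0.
  move=> db u /(coord_vbasis) ->.
  apply: (big_ind (fun u => tform d u = 0)); first exact: tform0r.
    by move=> u1 u2 d1 d2; rewrite -[u1]scale1r tformPr d1 d2 mulr0 addr0.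
  by move=> i _; rewrite -[_ *: _]addr0 tformPr db mulr0 tform0r addr0.
(* A row killed by G is the coordinate row of a vector of U orthogonal to U, hence to itself. *)
have Gu : G \in unitmx.
  rewrite -row_free_unit -kermx_eq0; apply/rowV0P => c /sub_kermxP cG.
  pose w := \sum_i c 0 i *: b`_i.
  have w0 : w = 0.
    by apply: tform_eq0; apply: orthb (bU c) => j; rewrite -comb cG mxE.
  apply/rowP => j; rewrite mxE.
  have /freeP/(_ (fun i => c 0 i) w0 j) := basis_free (vbasisP U).
  by [].
pose c := (\row_j tform p b`_j) *m invmx G.
exists (\sum_i c 0 i *: b`_i); first exact: bU.
apply: orthb => j; rewrite -[tform _ _]/(tform_with _ _) linearB /= /tform_with.
by rewrite -comb /c mulmxKV // mxE subrr.
Qed.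

End Form.

(** * Submodules generated by highest-weight vectors *)

Section Modules.
Variables (K : numClosedFieldType) (n : nat).
Implicit Types (p q d v : S3gl K n) (U W : {vspace S3gl K n}).

Definition upper_killed p :=
  forall a b : 'I_n, (a < b)%N -> glact (delta_mx a b) p = 0.

(** The space U(n^-) v, where n^- is the algebra of strictly lower triangular matrices. *)
Inductive lowered v : S3gl K n -> Prop :=
| lowered_self : lowered v v
| lowered_glact (a b : 'I_n) p of (a < b)%N & lowered v p :
    lowered v (glact (delta_mx b a) p)
| lowered_lin c p q of lowered v p & lowered v q : lowered v (c *: p + q).

Lemma lowered0 v : lowered v 0.
Proof.
have := lowered_lin (- 1) (lowered_self v) (lowered_self v).
by rewrite scaleN1r addNr.
Qed.

Lemma loweredZ c v p : lowered v p -> lowered v (c *: p).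
Proof. by move=> vp; rewrite -[_ *: _]addr0; apply: lowered_lin => //; apply: lowered0. Qed.

Lemma loweredD v p q : lowered v p -> lowered v q -> lowered v (p + q).
Proof. by move=> vp vq; rewrite -[p]scale1r; apply: lowered_lin. Qed.

Lemma glact_bracket_delta (a b c d : 'I_n) p :
  glact (delta_mx c d) (glact (delta_mx b a) p) =
  glact (delta_mx b a) (glact (delta_mx c d) p)
  + ((d == b)%:R *: glact (delta_mx c a) p - (a == c)%:R *: glact (delta_mx b d) p).
Proof.
rewrite glact_bracket !mul_delta_mx_cond; congr (_ + _).
rewrite -[delta_mx c a *+ _]scaler_nat -[delta_mx b d *+ _]scaler_nat.
by rewrite glactBl !glactZl.
Qed.

(** An operator is commuted past the last lowering operator. The bracket is a combination of matrix
    units, covered by the induction hypothesis since it concerns all of them. On v itself, raising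
    gives 0 and diagonal operators give scalars. *)
Lemma lowered_glact_all v lam : upper_killed v -> has_weight lam v ->
  forall p, lowered v p -> forall c d : 'I_n, lowered v (glact (delta_mx c d) p).
Proof.
move=> vu vw p; elim=> {p} [|a b p ab vp IHp|s p q vp IHp vq IHq] c d.
- have [cd|dc|/val_inj->] := ltngtP c d.
  + by rewrite vu //; apply: lowered0.
  + by apply: lowered_glact => //; apply: lowered_self.
  + by rewrite (glact_weight _ vw); apply/loweredZ/lowered_self.
- rewrite glact_bracket_delta; apply: loweredD.
    by apply: lowered_glact => //; apply: IHp.
  by rewrite -scaleNr; apply: loweredD; apply: loweredZ; apply: IHp.
- by rewrite linearP; apply: lowered_lin; [apply: IHp | apply: IHq].
Qed.

(** Across the form, a lowering operator becomes a raising operator, which kills d. *)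
Lemma lowered_orth v d : upper_killed d -> tform d v = 0 ->
  forall p, lowered v p -> tform d p = 0.
Proof.
move=> du dv p; elim=> {p} [//|a b p ab _ dp|s p q _ dp _ dq].
  by rewrite -tform_glact (du _ _ ab) -[LHS]/(tform_with p 0) (linear0 (tform_with p)).
by rewrite tformPr dp dq mulr0 addr0.
Qed.

Lemma lowered_diag v lam (t : 'rV[K]_n) : has_weight lam v ->
  (forall i, t 0 i != 0) ->
  forall p, lowered v p -> lowered v (GLact (diag_mx t) p).
Proof.
move=> vw t0 p; elim=> {p} [|a b p ab vp IHp|s p q vp IHp vq IHq].
- by have [c ->] := GLact_weight vw t0; apply/loweredZ/lowered_self.
- have tu : diag_mx t \in unitmx.
    rewrite unitmxE det_diag unitfE; apply/prodf_neq0 => i _; exact: t0.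
  rewrite GLact_glact //.
  have -> : diag_mx t *m delta_mx b a *m invmx (diag_mx t) = (t 0 b / t 0 a) *: delta_mx b a.
    apply/matrixP => i j.
    rewrite -[LHS]/(ent _ (i, j)) ent_diag_conj // /ent !mxE /=.
    by case: eqP => [->|_]; case: eqP => [->|_]; rewrite ?mulr0.
  by rewrite glactZl; apply/loweredZ/lowered_glact.
- by rewrite linearP; apply: lowered_lin; [apply: IHp | apply: IHq].
Qed.

Lemma lowered_GLstable v lam W : upper_killed v -> has_weight lam v ->
  (forall p, p \in W <-> lowered v p) -> GLstable W.
Proof.
move=> vu vw WP g.
apply: (unitmx_gen_ind (P := fun g => forall p, p \in W -> GLact g p \in W)).
- by move=> g1 h gu hu gW hW p pW; rewrite -GLact_mul //; apply/gW/hW.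
- move=> a b t ab p pW; apply: glact_GLact_transv pW => // q /WP vq.
  by apply/WP; apply: lowered_glact_all vu vw _ _ _ _.
- by move=> t t0 p /WP vp; apply/WP; apply: lowered_diag vw t0 _ _.
Qed.

(* Shifted by n, the height j - i of the weight of E_{i,j}: raising operators increase it. *)
Definition height (x : 'I_n * 'I_n) : nat := (x.2 + (n - x.1))%N.

(** As a < b, [eact a b] at an index reads only entries of strictly smaller height. *)
Lemma tens_height_glact (a b : 'I_n) p k : (a < b)%N ->
  (forall x y z, tens x y z p != 0 -> (k <= height x + height y + height z)%N) ->
  forall x y z, tens x y z (glact (delta_mx a b) p) != 0 ->
    (k < height x + height y + height z)%N.
Proof.
move=> ab pk x y z; rewrite ltnNge; apply: contraNN => xk.
have slot (f : 'I_n * 'I_n -> K) (m : nat) (w : 'I_n * 'I_n) :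
    (forall u : 'I_n * 'I_n, f u != 0 -> (k <= height u + m)%N) ->
    (height w + m <= k)%N -> eact a b f w = 0.
  move=> fk wk; have bn := ltn_ord b.
  have f0 u : (height u < height w)%N -> f u = 0.
    by move=> uw; apply/eqP; apply: contraTT wk => /fk; lia.
  rewrite /eact; have [wa|_] := eqVneq w.1 a; have [wb|_] := eqVneq w.2 b;
    rewrite ?mul0r ?mul1r ?f0 ?subr0 ?sub0r ?oppr0 // /height ?wa ?wb /=; lia.
rewrite tens_glact (slot _ (height y + height z)%N) ?(slot _ (height x + height z)%N y)
  ?(slot _ (height x + height y)%N z) ?addr0 //.
- by move=> u /pk; rewrite addnC.
- by move: xk; rewrite addnC.
- by move=> u /pk; lia.
- by move: xk; lia.
- by move=> u /pk; lia.
- by move: xk; lia.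
Qed.

(** Raising operators increase the least total height in the support, which is bounded, so applying
    them must end. P may be membership in a subspace or orthogonality to one. *)
Lemma upper_killed_exists (P : S3gl K n -> Prop) p :
  (forall (a b : 'I_n) q, (a < b)%N -> P q -> P (glact (delta_mx a b) q)) ->
  P p -> p != 0 -> exists d, [/\ P d, d != 0 & upper_killed d].
Proof.
move=> Pglact.
suff main m q : P q -> q != 0 -> (forall x y z, tens x y z q != 0 ->
    (6 * n + 1 - m <= height x + height y + height z)%N) ->
    exists d, [/\ P d, d != 0 & upper_killed d].
  (* Each height is below 2 n, so a total height of 6 n + 1 is out of reach; with m = 6 n + 1 the
     lower bound is void. *)
  by move=> Pp p0; apply: (main (6 * n + 1)%N p) => // x y z _; rewrite subnn.
elim: m q => [|m IHm] q Pq q0 qht.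
  case/negP: q0; apply/eqP/tens_eq0 => x y z; apply/eqP; apply: contraT => /qht.
  have := ltn_ord x.1; have := ltn_ord x.2; have := ltn_ord y.1.
  have := ltn_ord y.2; have := ltn_ord z.1; have := ltn_ord z.2.
  by rewrite /height; lia.
have [qu|nqu] := EM (upper_killed q); first by exists q.
have [a [b [ab Eq]]] : exists a b : 'I_n, (a < b)%N /\ glact (delta_mx a b) q != 0.
  apply: contrapT => noab; apply: nqu => a b ab; apply/eqP; apply: contraT => Eq.
  by case: noab; exists a, b.
apply: (IHm _ (Pglact _ _ _ ab Pq) Eq) => x y z.
by move/(tens_height_glact ab qht); lia.
Qed.

Lemma tform_sum_eq0 d (I : finType) (J : pred I) (W : I -> {vspace S3gl K n}) :
  (forall k, J k -> forall p, p \in W k -> tform d p = 0) ->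
  forall p, p \in (\sum_(k | J k) W k)%VS -> tform d p = 0.
Proof.
move=> dW p /memv_sumP[u uW ->].
apply: (big_ind (fun p => tform d p = 0)) => [|q r dq dr|k Jk]; first exact: tform0r.
  by rewrite -[q]scale1r tformPr dq dr mulr0 addr0.
by apply: dW (uW k Jk).
Qed.

(** * Irreducibility, directness and exhaustion for the generated submodules *)

Section Decomposition.
Variables (N : nat) (v : 'I_N -> S3gl K n) (lam : 'I_N -> 'rV[int]_n).
Hypothesis v_upper : forall k, upper_killed (v k).
Hypothesis v_weight : forall k, has_weight (lam k) (v k).
Variable W : 'I_N -> {vspace S3gl K n}.
Hypothesis WP : forall k p, p \in W k <-> lowered (v k) p.

Lemma generator_mem k : v k \in W k.
Proof. by apply/WP; apply: lowered_self. Qed.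

Lemma generated_glact k p a b : p \in W k -> glact (delta_mx a b) p \in W k.
Proof.
by move=> /WP vp; apply/WP; apply: (lowered_glact_all (@v_upper k) (@v_weight k)).
Qed.

(* A vector killed by the raising operators and orthogonal to the v k is
   orthogonal to everything the lowering operators make out of them. *)
Lemma upper_killed_span (J : pred 'I_N) d : upper_killed d ->
  d \in (\sum_(k | J k) W k)%VS -> d \in (\sum_(k | J k) <[v k]>)%VS.
Proof.
move=> du dW; have [h hv orth] := orth_proj (\sum_(k | J k) <[v k]>)%VS d.
have hu : upper_killed h.
  move=> a b ab; have /memv_sumP[u uv ->] := hv.
  rewrite linear_sum big1 // => k Jk; have /vlineP[c ->] := uv k Jk.
  by rewrite linearZ /= v_upper // scaler0.
have eu : upper_killed (d - h) by move=> a b ab; rewrite linearB /= du // hu // subr0.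
have hW : h \in (\sum_(k | J k) W k)%VS.
  have /memv_sumP[u uv ->] := hv; apply: memv_sumr => k Jk.
  by have /vlineP[c ->] := uv k Jk; apply/memvZ/generator_mem.
(* The vector d - h is orthogonal to the generators, hence to the whole sum of the W k, where it
   lies. *)
suff /eqP : tform (d - h) (d - h) = 0.
  by move/eqP/tform_eq0/eqP; rewrite subr_eq0 => /eqP->.
apply: tform_sum_eq0 (memvB dW hW) => k Jk p /WP; apply: (lowered_orth eu).
by apply: orth; rewrite (subvP (sumv_sup k Jk (subvv _))) ?memv_line.
Qed.

Hypothesis v_free : forall c : 'I_N -> K, \sum_k c k *: v k = 0 -> forall k, c k = 0.
Hypothesis v_complete : forall d, upper_killed d -> d \in (\sum_k <[v k]>)%VS.

(** A nonzero stable U inside W k contains a nonzero vector killed by the raising operators. That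
    vector is a multiple of v k, so U contains v k and all that is lowered from it. *)
Lemma generated_irreducible k : GLirreducible (W k).
Proof.
have stW : GLstable (W k).
  exact: lowered_GLstable (@v_upper k) (@v_weight k) (@WP k).
split=> // [|U stU UW].
  apply/eqP => W0; have := generator_mem k; rewrite W0 memv0 => /eqP vk0.
  have := v_free (c := fun j => (j == k)%:R); rewrite (bigD1 k) //= vk0 scaler0.
  rewrite big1 ?addr0 => [|j jk]; last by rewrite (negPf jk) scale0r.
  by move=> /(_ erefl k) /eqP; rewrite eqxx oner_eq0.
have [U0|U0] := eqVneq U 0%VS; [by left | right].
have [d [dU d0 du]] : exists d, [/\ d \in U, d != 0 & upper_killed d].
  apply: (upper_killed_exists (P := fun q => q \in U)) (memv_pick U) _.
    by move=> a b q ab qU; apply: GLstable_glact => //; rewrite neq_ltn ab.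
  by rewrite vpick0.
have := upper_killed_span (J := pred1 k) du; rewrite !big_pred1_eq.
move/(_ (subvP UW _ dU))/vlineP => [c dE].
have c0 : c != 0 by apply: contraNneq d0 => c0; rewrite dE c0 scale0r.
have vU : v k \in U by move: dU; rewrite dE rpredZeq (negPf c0).
apply/eqP; rewrite eqEsubv UW /=; apply/subvP => p /WP.
elim=> {p} [//|a b p ab _ pU|s p q _ pU _ qU]; last by rewrite memvD ?memvZ.
by apply: GLstable_glact => //; rewrite neq_ltn ab orbT.
Qed.

(** A nonzero intersection would contain a nonzero vector killed by the raising operators, both a
    multiple of v k and a combination of the other generators. *)
Lemma generated_direct : directv (\sum_k W k).
Proof.
apply/directv_sumP => k _; apply/eqP; apply: contraT => I0.
have [d [dI d0 du]] : exists d,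
    [/\ d \in (W k :&: \sum_(j | j != k) W j)%VS, d != 0 & upper_killed d].
  apply: (upper_killed_exists (P := fun q => q \in _)) (memv_pick _) _.
    move=> a b q ab; rewrite !memv_cap => /andP[qk /memv_sumP[u uW qE]].
    rewrite generated_glact //= qE linear_sum.
    by apply: memv_sumr => j jk; apply/generated_glact/uW.
  by rewrite vpick0.
move: dI; rewrite memv_cap => /andP[dk dj].
have := upper_killed_span (J := pred1 k) du; rewrite !big_pred1_eq.
move/(_ dk)/vlineP => [c dE].
have /memv_sumP[u uv dE'] := upper_killed_span du dj.
have [e ue] : {e : 'I_N -> K & forall j, j != k -> u j = e j *: v j}.
  apply: (@choice _ _ (fun j e => j != k -> u j = e *: v j)) => j.
  have [jk|jk] := eqVneq j k; first by exists 0.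
  by have /vlineP[e ->] := uv j jk; exists e.
have := v_free (c := fun j => if j == k then c else - e j).
rewrite (bigD1 k) //= eqxx -dE dE' -big_split big1 => [|j jk]; last first.
  by rewrite /= (negPf jk) ue // scaleNr addrN.
by move/(_ erefl k); rewrite eqxx => c0; move: d0; rewrite dE c0 scale0r eqxx.
Qed.

(** The orthogonal complement of the sum is stable under raising operators. If nonzero, it contains
    a killed vector, which by completeness lies in the sum and is therefore orthogonal to itself. *)
Lemma generated_full : (\sum_k W k)%VS = fullv.
Proof.
apply/eqP; rewrite eqEsubv subvf; apply/subvP => p _; apply: contraT => pW.
have [h hW orth] := orth_proj (\sum_k W k)%VS p.
have [d [dW d0 du]] : exists d, [/\ forall u, u \in (\sum_k W k)%VS -> tform d u = 0,
    d != 0 & upper_killed d].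
  apply: (upper_killed_exists
    (P := fun q => forall u, u \in (\sum_k W k)%VS -> tform q u = 0)) orth _.
    move=> a b q ab qW u /memv_sumP[w wW ->]; rewrite tform_glact; apply: qW.
    by rewrite linear_sum; apply: memv_sumr => j _; apply/generated_glact/wW.
  by apply: contraNneq pW => /eqP; rewrite subr_eq0 => /eqP->.
have dV : d \in (\sum_k W k)%VS.
  have /memv_sumP[u uv ->] := v_complete du; apply: memv_sumr => k _.
  by have /vlineP[c ->] := uv k isT; apply/memvZ/generator_mem.
by move: d0; rewrite (tform_eq0 (dW d dV)) eqxx.
Qed.

End Decomposition.

Theorem highest_weight_decomposition (N : nat) (v : 'I_N -> S3gl K n)
    (lam : 'I_N -> 'rV[int]_n) :
  (forall k, upper_killed (v k)) -> (forall k, has_weight (lam k) (v k)) ->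
  (forall c : 'I_N -> K, \sum_k c k *: v k = 0 -> forall k, c k = 0) ->
  (forall d, upper_killed d -> d \in (\sum_k <[v k]>)%VS) ->
  exists W : 'I_N -> {vspace S3gl K n},
    [/\ forall k, GLirreducible (W k), directv (\sum_k W k),
        (\sum_k W k)%VS = fullv & forall k, v k \in W k].
Proof.
move=> vu vw vf vc.
have [W WP] : {W : 'I_N -> {vspace S3gl K n} & forall k p, p \in W k <-> lowered (v k) p}.
  apply: (@choice _ _ (fun k W => forall p, p \in W <-> lowered (v k) p)) => k.
  apply: vspace_of_pred; first exact: lowered0.
  by move=> a p q; apply: lowered_lin.
exists W; split.
- exact: (generated_irreducible vu vw WP vf).
- exact: (generated_direct vu vw WP vf).
- exact: (generated_full vu vw WP vc).
- exact: (generator_mem WP).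
Qed.

End Modules.

(** * Tensors killed by the raising operators *)

(* The codes 0, 1, 2, 3, 4, 5 stand for the indices 1, 2, 3, n-2, n-1, n of gl_n. *)
Definition code : Type := nat * nat.
Definition code3 : Type := code * code * code.

(* Unlike has, all and the boolean connectives, any, every and the nested
   conditionals below stop early under call-by-value evaluation too. *)
Fixpoint any T (a : T -> bool) s :=
  if s is x :: s' then if a x then true else any a s' else false.

Fixpoint every T (a : T -> bool) s :=
  if s is x :: s' then if a x then every a s' else false else true.

Lemma anyE T (a : T -> bool) s : any a s = has a s.
Proof. by elim: s => //= x s ->; case: (a x). Qed.
Lemma everyE T (a : T -> bool) s : every a s = all a s.
Proof. by elim: s => //= x s ->; case: (a x). Qed.

Definition code_eq (x y : code) := if eqn x.1 y.1 then eqn x.2 y.2 else false.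

(** Equality up to the order of the slots, which does not affect the entry of a symmetric tensor. *)
Definition same (s u : code3) :=
  let: (x, y, z) := s in let: (x', y', z') := u in
  if code_eq x x' then if code_eq y y' then code_eq z z'
                       else if code_eq y z' then code_eq z y' else false
  else if code_eq x y' then if code_eq y x' then code_eq z z'
                       else if code_eq y z' then code_eq z x' else false
  else if code_eq x z' then if code_eq y x' then code_eq z y'
                       else if code_eq y y' then code_eq z x' else false
  else false.

Definition code_ok (x : code) := if ltn x.1 6 then ltn x.2 6 else false.
Definition code3_ok (s : code3) :=
  let: (x, y, z) := s in
  if code_ok x then if code_ok y then code_ok z else false else false.

(** The terms of [eact] in one slot; [wrap] puts the modified slot back among the other two. *)
Definition eterms a b (x : code) (wrap : code -> code3) : seq (bool * code3) :=
  let r := if eqn x.2 b then [:: (false, wrap (x.1, a))] else [::] in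
  if eqn x.1 a then (true, wrap (b, x.2)) :: r else r.

(* The terms, with true for the sign +, of the relation which says that E_{a,b}
   kills the tensor, read at the entry s. *)
Definition relation a b (s : code3) : seq (bool * code3) :=
  let: (x, y, z) := s in
  eterms a b x (fun x' => (x', y, z)) ++ eterms a b y (fun y' => (x, y', z))
  ++ eterms a b z (fun z' => (x, y, z')).

(* The relations (a, b, u) tried for an entry: they lower a row index to one of the
   first three codes or raise a column index to one of the last three. *)
Definition moves (x : code) (wrap : code -> code3) : seq (nat * nat * code3) :=
  [seq (a, x.1, wrap (a, x.2)) | a <- iota 0 (minn x.1 3)]
  ++ [seq (x.2, b, wrap (x.1, b)) | b <- iota (maxn x.2.+1 3) (6 - maxn x.2.+1 3)].

Definition candidates (s : code3) : seq (nat * nat * code3) :=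
  let: (x, y, z) := s in
  moves x (fun x' => (x', y, z)) ++ moves y (fun y' => (x, y', z))
  ++ moves z (fun z' => (x, y, z')).

(** A search for a proof that the entry s vanishes: s is a probe, or some relation contains s with a
    nonzero total coefficient while its other entries vanish by a shorter search. The two counts
    compare the positive and negative occurrences of s. *)
Fixpoint forced_zero (probes : seq code3) (fuel : nat) (s : code3) : bool :=
  if code3_ok s then
    if any (same s) probes then true else
    if fuel is f.+1 then
      any (fun c => let: (a, b, u) := c in
        if code3_ok u then if ltn a b then if ltn b 6 then
          let R := relation a b u in
          if eqn (count (fun r => r.1 && same r.2 s) R)
                 (count (fun r => ~~ r.1 && same r.2 s) R) then false
          else every (fun r => if same r.2 s then true else forced_zero probes f r.2) R
        else false else false else false) (candidates s)
    else false
  else false.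

(* The l-th listed vector is nonzero at the l-th probe, and only there. *)
Definition probes : seq code3 :=
[::
((0,0),(1,1),(2,2));
((0,0),(1,2),(2,1));
((0,1),(1,2),(2,0));
((0,5),(1,1),(2,2));
((1,1),(0,2),(2,5));
((0,5),(1,2),(2,1));
((0,1),(1,2),(2,5));
((1,1),(0,5),(0,5));
((0,5),(0,1),(1,5));
((0,5),(1,2),(2,5));
((0,5),(0,1),(1,4));
((2,2),(0,5),(1,4));
((0,5),(1,2),(2,4));
((0,5),(0,5),(0,5));
((0,5),(0,4),(1,5));
((0,5),(1,4),(2,3))]%N.

(** Iterative deepening on the fuel. The four column patterns, completed by column code 5, are those
    from which all other columns are reached later. *)
Definition all_forced_zero : bool :=
  every (fun j : nat * nat => every (fun i1 => every (fun i2 => every (fun i3 =>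
    any (fun f => forced_zero probes f ((i1, j.1), (i2, j.2), (i3, 5))) (iota 0 5))
   (iota 0 6)) (iota 0 6)) (iota 0 6)) [:: (5, 5); (4, 5); (4, 4); (3, 4)].

Lemma all_forced_zeroT : all_forced_zero.
Proof. by vm_compute. Qed.

(** * Soundness of the search for vanishing entries *)

Section Soundness.
Variables (K : numFieldType) (n : nat).
Let P : Type := ('I_n * 'I_n)%type.
Variable t : P -> P -> P -> K.
Hypothesis tC : forall x y z, t x y z = t y x z.
Hypothesis tAC : forall x y z, t x y z = t x z y.

Hypothesis t_rel : forall (a b : 'I_n), (a < b)%N -> forall x y z,
  eact a b (fun x => t x y z) x + eact a b (fun y => t x y z) y
  + eact a b (fun z => t x y z) z = 0.

Variable iota6 : nat -> 'I_n.
Hypothesis iota6_mono : forall a b, (a < b)%N -> (b < 6)%N -> (iota6 a < iota6 b)%N.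

Lemma iota6_inj a b : (a < 6)%N -> (b < 6)%N -> (iota6 a == iota6 b) = (a == b).
Proof.
move=> a6 b6; have [ab|ba|->] := ltngtP a b; last by rewrite eqxx.
  by apply/negbTE; rewrite -(inj_eq val_inj) neq_ltn iota6_mono.
by apply/negbTE; rewrite -(inj_eq val_inj) neq_ltn (iota6_mono ba) ?orbT.
Qed.

Definition emb (x : code) : P := (iota6 x.1, iota6 x.2).
Definition val3 (s : code3) : K :=
  let: (x, y, z) := s in t (emb x) (emb y) (emb z).

Lemma code_eqP x y : code_eq x y -> x = y.
Proof.
by case: x y => [a b] [c d]; rewrite /code_eq /=; case: ifP => // /eqnP-> /eqnP->.
Qed.

Lemma val3_same s u : same s u -> val3 s = val3 u.
Proof.
case: s u => [[x y] z] [[x' y'] z'] /=.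
case: ifP => [/code_eqP->|_].
  case: ifP => [/code_eqP-> /code_eqP-> //|_]; case: ifP => // /code_eqP-> /code_eqP->.
  by rewrite tAC.
case: ifP => [/code_eqP->|_].
  case: ifP => [/code_eqP-> /code_eqP->|_]; first by rewrite tC.
  by case: ifP => // /code_eqP-> /code_eqP->; rewrite tAC tC.
case: ifP => // /code_eqP->.
case: ifP => [/code_eqP-> /code_eqP->|_]; first by rewrite tC tAC.
by case: ifP => // /code_eqP-> /code_eqP->; rewrite tC tAC tC.
Qed.

Definition signed_sum (R : seq (bool * code3)) : K :=
  \sum_(r <- R) (-1) ^+ (~~ r.1) * val3 r.2.

Lemma signed_sum_eterms a b x wrap (f : P -> K) :
  (a < 6)%N -> (b < 6)%N -> code_ok x -> (forall x', val3 (wrap x') = f (emb x')) ->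
  signed_sum (eterms a b x wrap) = eact (iota6 a) (iota6 b) f (emb x).
Proof.
move=> a6 b6; rewrite /code_ok; case: ifP => // x1 x2 fE.
rewrite /signed_sum /eterms /eact /emb /= !iota6_inj //.
rewrite -![eqn _ _]/(_ == _).
by case: (x.1 == a); case: (x.2 == b);
  rewrite !(big_cons, big_nil) /= ?fE /emb /=; ring.
Qed.

Lemma signed_sum_relation a b s : (a < b)%N -> (b < 6)%N -> code3_ok s ->
  signed_sum (relation a b s) = 0.
Proof.
move=> ab b6; case: s => [[x y] z] /=.
case: ifP => // xok; case: ifP => // yok zok; have a6 := ltn_trans ab b6.
rewrite /signed_sum !big_cat /= -!/(signed_sum _) addrA.
rewrite (signed_sum_eterms (f := fun x' => t x' (emb y) (emb z))) //.
rewrite (signed_sum_eterms (f := fun y' => t (emb x) y' (emb z))) //.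
rewrite (signed_sum_eterms (f := fun z' => t (emb x) (emb y) z')) //.
by apply: t_rel; apply: iota6_mono.
Qed.

(** The terms equivalent to s are collected with their signs; all others vanish. *)
Lemma signed_sum_same s R :
  (forall r, r \in R -> ~~ same r.2 s -> val3 r.2 = 0) ->
  signed_sum R = (count (fun r => r.1 && same r.2 s) R)%:R * val3 s
                 - (count (fun r => ~~ r.1 && same r.2 s) R)%:R * val3 s.
Proof.
elim: R => [|[b u] R IHR] R0; first by rewrite /signed_sum big_nil /= !mul0r subr0.
rewrite /signed_sum big_cons -/(signed_sum R) IHR => [|r rR]; last first.
  by apply: R0; rewrite inE rR orbT.
rewrite /= !natrD; have [us|us] := boolP (same u s).
  by rewrite (val3_same us); case: b {R0} => /=; ring.
by rewrite (R0 (b, u)) ?inE ?eqxx //= !andbF; ring.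
Qed.

Lemma forced_zeroP ps f s : (forall p, p \in ps -> val3 p = 0) ->
  forced_zero ps f s -> val3 s = 0.
Proof.
move=> ps0; elim: f s => [|f IHf] s /=; case: ifP => // sok.
  by rewrite anyE; case: hasP => // -[p pp sp] _; rewrite (val3_same sp) ps0.
rewrite !anyE; case: hasP => [[p pp sp] _|_]; first by rewrite (val3_same sp) ps0.
case/hasP => -[[a b] u] _; case: ifP => // uok; case: ifP => // ab; case: ifP => // b6.
case: ifP => // /negbT; rewrite -[eqn _ _]/(_ == _) everyE => cNeq /allP R0.
have := signed_sum_relation ab b6 uok; rewrite (@signed_sum_same s); last first.
  by move=> r /R0; case: ifP => // _ /IHf.
by rewrite -mulrBl => /eqP; rewrite mulf_eq0 subr_eq0 eqr_nat (negPf cNeq) => /eqP.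
Qed.

End Soundness.

(** Zero-based: codes 0, 1, 2 give themselves and codes 3, 4, 5 give n-3, n-2, n-1. Larger codes are
    clamped to n-1 so that the value stays below n. *)
Definition code_val n k := (if k < 3 then k else n - 6 + minn k 5)%N.

Fact code_val_lt n k : (6 <= n)%N -> (code_val n k < n)%N.
Proof. by rewrite /code_val => n6; case: (ltnP k 3) => k3; lia. Qed.

Definition code_ord n (n6 : (6 <= n)%N) k : 'I_n := Ordinal (code_val_lt k n6).

Lemma code_ord_mono n (n6 : (6 <= n)%N) a b :
  (a < b)%N -> (b < 6)%N -> (code_ord n6 a < code_ord n6 b)%N.
Proof. by rewrite /= /code_val => ab b6; case: (ltnP a 3); case: (ltnP b 3); lia. Qed.

(** * From the coded entries to all entries of the tensor *)

Section Determination.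
Variables (K : numFieldType) (n : nat) (n6 : (6 <= n)%N).
Let P : Type := ('I_n * 'I_n)%type.
Variable t : P -> P -> P -> K.
Hypothesis tC : forall x y z, t x y z = t y x z.
Hypothesis tAC : forall x y z, t x y z = t x z y.
Hypothesis t_rel : forall (a b : 'I_n), (a < b)%N -> forall x y z,
  eact a b (fun x => t x y z) x + eact a b (fun y => t x y z) y
  + eact a b (fun z => t x y z) z = 0.
Local Notation c := (code_ord n6).
Hypothesis t_probes : forall p, p \in probes -> val3 t c p = 0.

Lemma t_coded j i1 i2 i3 : j \in [:: (5, 5); (4, 5); (4, 4); (3, 4)]%N ->
  (i1 < 6)%N -> (i2 < 6)%N -> (i3 < 6)%N ->
  t (c i1, c j.1) (c i2, c j.2) (c i3, c 5) = 0.
Proof.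
have := all_forced_zeroT; rewrite /all_forced_zero everyE => /allP t0 /t0.
rewrite everyE => /allP t1 i1_6 i2_6 i3_6.
have := t1 i1; rewrite mem_iota => /(_ i1_6); rewrite everyE => /allP /(_ i2).
rewrite mem_iota => /(_ i2_6); rewrite everyE => /allP /(_ i3).
rewrite mem_iota => /(_ i3_6); rewrite anyE => /hasP[f _].
exact: (forced_zeroP tC tAC t_rel (@code_ord_mono n n6) t_probes).
Qed.

Definition coded (i : 'I_n) := (i < 3)%N || (n - 3 <= i)%N.

Lemma codedP i : reflect (exists2 k, (k < 6)%N & i = c k) (coded i).
Proof.
apply: (iffP idP) => [i6|[k k6 ->]]; last first.
  by rewrite /coded /= /code_val; case: (ltnP k 3); lia.
have i_n := ltn_ord i; move: i6; rewrite /coded; case: (ltnP i 3) => i3 /= i6.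
  by exists i; [lia | apply: val_inj; rewrite /= /code_val i3].
exists (i - (n - 6))%N; first by lia.
by apply: val_inj; rewrite /= /code_val; case: ltnP; lia.
Qed.

Lemma eact_eq0 a b (f : P -> K) x :
  (x.1 == a -> f (b, x.2) = 0) -> (x.2 == b -> f (x.1, a) = 0) -> eact a b f x = 0.
Proof.
by rewrite /eact => h1 h2; case: eqP h1 => [_ ->|_ _] //; case: eqP h2 => [_ ->|_ _] //;
  rewrite ?(mulr0, mul0r) subr0.
Qed.

(* A row index that is not a column index can be lowered to one of the first three
   indices, avoiding the other two row indices. *)
Lemma t_uncoded (x y z : P) : ~~ coded x.1 -> (n - 3 <= x.2)%N -> (n - 3 <= y.2)%N ->
  (n - 3 <= z.2)%N -> t x y z = 0.
Proof.
case: x => b j /=; rewrite /coded negb_or -leqNgt -ltnNge => /andP[b3 bn] jx jy jz.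
(* Two row indices have to be avoided and three values are available. *)
have [k [k3 ky kz]] : exists k, [/\ (k < 3)%N, k != y.1 :> nat & k != z.1 :> nat].
  have [|h0] := boolP ((y.1 != 0%N :> nat) && (z.1 != 0%N :> nat)).
    by exists 0%N; split; lia.
  have [|h1] := boolP ((y.1 != 1%N :> nat) && (z.1 != 1%N :> nat)).
    by exists 1%N; split; lia.
  by exists 2%N; split; lia.
have kn : (k < n)%N by lia.
have kb : (Ordinal kn < b)%N by rewrite /=; lia.
(* In this relation only the term that replaces row k by row b survives. *)
have := t_rel kb (Ordinal kn, j) y z.
rewrite [X in _ + X + _]eact_eq0 ?[X in _ + _ + X]eact_eq0 ?addr0.
- rewrite /eact /= eqxx mul1r.
  have -> : (j == b) = false by apply/eqP => jb; move: jx; rewrite jb; lia.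
  by rewrite mul0r subr0.
- by move=> /eqP zk; move: kz; rewrite zk eqxx.
- by move=> /eqP zb; move: jz; rewrite zb; lia.
- by move=> /eqP yk; move: ky; rewrite yk eqxx.
- by move=> /eqP yb; move: jy; rewrite yb; lia.
Qed.

Lemma t_top j i1 i2 i3 : j \in [:: (5, 5); (4, 5); (4, 4); (3, 4)]%N ->
  t (i1, c j.1) (i2, c j.2) (i3, c 5) = 0.
Proof.
move=> jP; have [j1 j2] : (n - 3 <= c j.1)%N /\ (n - 3 <= c j.2)%N.
  by move: jP; rewrite !inE => /or4P[] /eqP-> /=; rewrite /code_val /=; lia.
have j3 : (n - 3 <= c 5)%N by rewrite /= /code_val /=; lia.
have [/codedP[k1 k1_6 ->]|u1] := boolP (coded i1); last by rewrite t_uncoded.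
have [/codedP[k2 k2_6 ->]|u2] := boolP (coded i2); last by rewrite tC t_uncoded.
have [/codedP[k3 k3_6 ->]|u3] := boolP (coded i3); last by rewrite tAC tC t_uncoded.
exact: t_coded.
Qed.

Lemma lt_c5 (a : 'I_n) : a != c 5 -> (a < c 5)%N.
Proof. by have := ltn_ord a; rewrite -(inj_eq val_inj) /= /code_val /= => ? /eqP; lia. Qed.
Lemma lt_c4 (a : 'I_n) : a != c 5 -> a != c 4 -> (a < c 4)%N.
Proof.
move=> /lt_c5; rewrite -(inj_eq val_inj) /= /code_val /= => ? /eqP; lia.
Qed.
Lemma lt_c3 (a : 'I_n) : a != c 5 -> a != c 4 -> a != c 3 -> (a < c 3)%N.
Proof.
move=> /lt_c4 /[apply]; rewrite -(inj_eq val_inj) /= /code_val /= => ? /eqP; lia.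
Qed.

Lemma c_neq k l : (k < 6)%N -> (l < 6)%N -> (c k == c l) = (k == l).
Proof. by move=> k6 l6; rewrite (iota6_inj (@code_ord_mono n n6)). Qed.

(** The relation for E_{j,c 4}, read at column [c 4] of the first slot, yields the entry with column
    j; all other terms have a column pattern known to vanish. The next lemmas free the remaining
    columns by the same exchange with [c 3], [c 4] and [c 5]. *)
Lemma t_c5c5 x i2 i3 : t x (i2, c 5) (i3, c 5) = 0.
Proof.
case: x => i1 j; have [->|j5] := eqVneq j (c 5); first exact: (@t_top (5, 5)%N).
have t4 i i' i'' : t (i, c 4) (i', c 5) (i'', c 5) = 0 by exact: (@t_top (4, 5)%N).
have [->//|j4] := eqVneq j (c 4).
have := t_rel (lt_c4 j5 j4) (i1, c 4) (i2, c 5) (i3, c 5).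
rewrite [X in _ + X + _]eact_eq0 ?[X in _ + _ + X]eact_eq0 ?addr0 /= ?c_neq //.
rewrite /eact /= eqxx mul1r t4 mulr0 sub0r => /eqP; rewrite oppr_eq0 => /eqP //.
Qed.

Lemma t_c4c5 x i2 i3 : t x (i2, c 4) (i3, c 5) = 0.
Proof.
case: x => i1 j; have [->|j5] := eqVneq j (c 5).
  by rewrite tC -(@t_top (4, 5)%N i2 i1 i3).
have [->|j4] := eqVneq j (c 4); first exact: (@t_top (4, 4)%N).
have t3 i i' i'' : t (i, c 3) (i', c 4) (i'', c 5) = 0 by exact: (@t_top (3, 4)%N).
have [->//|j3] := eqVneq j (c 3).
have := t_rel (lt_c3 j5 j4 j3) (i1, c 3) (i2, c 4) (i3, c 5).
rewrite [X in _ + X + _]eact_eq0 ?[X in _ + _ + X]eact_eq0 ?addr0 /= ?c_neq //.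
rewrite /eact /= eqxx mul1r t3 mulr0 sub0r => /eqP; rewrite oppr_eq0 => /eqP //.
Qed.

Lemma t_c5 x y i3 : t x y (i3, c 5) = 0.
Proof.
case: y => i2 j; have [->|j5] := eqVneq j (c 5); first exact: t_c5c5.
have [->|j4] := eqVneq j (c 4); first exact: t_c4c5.
have := t_rel (lt_c4 j5 j4) x (i2, c 4) (i3, c 5).
rewrite [X in X + _ + _]eact_eq0 ?[X in _ + _ + X]eact_eq0 ?addr0 ?add0r /= ?t_c4c5 ?c_neq //.
rewrite /eact /= eqxx mul1r t_c4c5 mulr0 sub0r => /eqP; rewrite oppr_eq0 => /eqP //.
Qed.

Lemma highest_weight_tensor_eq0 x y z : t x y z = 0.
Proof.
case: z => i3 j; have [->|j5] := eqVneq j (c 5); first exact: t_c5.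
have := t_rel (lt_c5 j5) x y (i3, c 5).
rewrite [X in X + _ + _]eact_eq0 ?[X in _ + X + _]eact_eq0 ?addr0 ?add0r ?t_c5 //.
rewrite /eact /= eqxx mul1r t_c5 mulr0 sub0r => /eqP; rewrite oppr_eq0 => /eqP //.
Qed.

End Determination.

(** * Contractions *)

Section Contractions.
Variables (K : numFieldType) (n : nat).
Implicit Types (A P X : 'M[K]_n) (p q : S3gl K n) (x y z : 'I_n * 'I_n).

(* The sums over indices in the listed vectors are the values at 1 and at matrix
   units of these equivariant maps: contr2 A E_{p,q} is the sum of the
   A E_{p,i} E_{i,q}, and contr3 E_{p,q} that of the E_{p,i} E_{i,j} E_{j,q}. *)
Definition contr2 A P : S3gl K n :=
  \sum_i \sum_j prod3 A (P *m delta_mx i j) (delta_mx j i).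

Definition contr3 P : S3gl K n :=
  \sum_i \sum_j \sum_k prod3 (P *m delta_mx i j) (delta_mx j k) (delta_mx k i).

Lemma ent_mul_delta P i j x : ent (P *m delta_mx i j) x = P x.1 i * (j == x.2)%:R.
Proof.
rewrite /ent mxE (bigD1 i) //= big1 => [|k ki]; first by rewrite mxE eqxx addr0 eq_sym.
by rewrite mxE (negPf ki) mulr0.
Qed.

Lemma ent_delta i j x : ent (delta_mx i j : 'M[K]_n) x = (i == x.1)%:R * (j == x.2)%:R.
Proof. by rewrite /ent mxE -natrM mulnb (eq_sym i) (eq_sym j). Qed.

Lemma sum_pick i (F : 'I_n -> K) : \sum_k (k == i)%:R * F k = F i.
Proof.
rewrite (bigD1 i) //= eqxx mul1r big1 ?addr0 // => k ki.
by rewrite (negPf ki) mul0r.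
Qed.

(** The entry left by the sum over i and j: adjacent indices must agree, and P carries the outer
    two. [link3] is the same for a chain of three. *)
Definition link2 P y z := P y.1 z.2 * (y.2 == z.1)%:R.
Definition link3 P x y z := P x.1 z.2 * (x.2 == y.1)%:R * (y.2 == z.1)%:R.

Lemma sum_link2 P y z :
  \sum_i \sum_j ent (P *m delta_mx i j) y * ent (delta_mx j i) z = link2 P y z.
Proof.
transitivity (\sum_i (i == z.2)%:R * (\sum_j (j == y.2)%:R * (P y.1 i * (j == z.1)%:R))).
  apply: eq_bigr => i _; rewrite mulr_sumr; apply: eq_bigr => j _.
  by rewrite ent_mul_delta ent_delta; ring.
by rewrite !sum_pick.
Qed.

Lemma sum_link3 P x y z :
  \sum_i \sum_j \sum_k ent (P *m delta_mx i j) x * ent (delta_mx j k) y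
    * ent (delta_mx k i) z = link3 P x y z.
Proof.
transitivity (\sum_i (i == z.2)%:R * (\sum_j (j == x.2)%:R * (\sum_k (k == y.2)%:R *
    (P x.1 i * (j == y.1)%:R * (k == z.1)%:R)))).
  apply: eq_bigr => i _; rewrite mulr_sumr; apply: eq_bigr => j _.
  rewrite !mulr_sumr; apply: eq_bigr => k _.
  by rewrite ent_mul_delta !ent_delta; ring.
by rewrite !sum_pick.
Qed.

Lemma tens_contr2 A P x y z : tens x y z (contr2 A P) =
    ent A x * (link2 P y z + link2 P z y) + ent A y * (link2 P x z + link2 P z x)
  + ent A z * (link2 P x y + link2 P y x).
Proof.
rewrite -!sum_link2 !mulrDr !mulr_sumr -!big_split linear_sum.
apply: eq_bigr => i _; rewrite !mulr_sumr -!big_split linear_sum.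
by apply: eq_bigr => j _; rewrite /= tens_prod3; ring.
Qed.

Lemma tens_contr3 P x y z : tens x y z (contr3 P) =
    link3 P x y z + link3 P x z y + link3 P y x z + link3 P y z x
  + link3 P z x y + link3 P z y x.
Proof.
rewrite -!sum_link3 -!big_split linear_sum.
apply: eq_bigr => i _; rewrite -!big_split linear_sum.
apply: eq_bigr => j _; rewrite -!big_split linear_sum.
by apply: eq_bigr => k _; rewrite /= tens_prod3; ring.
Qed.

Fact contr2_linearl P : linear (contr2 ^~ P).
Proof.
move=> a A B; apply/eqP; rewrite -subr_eq0; apply/eqP/tens_eq0 => x y z.
rewrite linearB /= linearP /= !tens_contr2 /ent !mxE; ring.
Qed.

Fact contr2_linearr A : linear (contr2 A).
Proof.
move=> a P Q; apply/eqP; rewrite -subr_eq0; apply/eqP/tens_eq0 => x y z.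
rewrite linearB /= linearP /= !tens_contr2 /link2 !mxE; ring.
Qed.
HB.instance Definition _ A :=
  GRing.isLinear.Build K _ _ _ (contr2 A) (contr2_linearr A).
Definition contr2_at P A := contr2 A P.
HB.instance Definition _ P :=
  GRing.isLinear.Build K _ _ _ (contr2_at P) (contr2_linearl P).

Fact contr3_linear : linear contr3.
Proof.
move=> a P Q; apply/eqP; rewrite -subr_eq0; apply/eqP/tens_eq0 => x y z.
rewrite linearB /= linearP /= !tens_contr3 /link3 !mxE; ring.
Qed.
HB.instance Definition _ :=
  GRing.isLinear.Build K _ _ _ contr3 contr3_linear.

Definition ad X A := X *m A - A *m X.

Lemma ad_delta a b A i j : ad (delta_mx a b) A i j = (i == a)%:R * A b j - (j == b)%:R * A i a.
Proof. exact: (ent_ad a b A (i, j)). Qed.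

(** The contracted tensor, the sum of the E_{i,j} and E_{j,i} in two slots, is invariant, so the
    bracket falls only on A and P. *)
Lemma glact_contr2 a b A P : glact (delta_mx a b) (contr2 A P) =
  contr2 (ad (delta_mx a b) A) P + contr2 A (ad (delta_mx a b) P).
Proof.
apply/eqP; rewrite -subr_eq0; apply/eqP/tens_eq0 => x y z.
rewrite linearB (linearD (tens x y z)) /= tens_glact /eact !tens_contr2.
rewrite /ent /link2 !ad_delta /=.
by rewrite !(eq_sym a); ring.
Qed.

Lemma glact_contr3 a b P : glact (delta_mx a b) (contr3 P) = contr3 (ad (delta_mx a b) P).
Proof.
apply/eqP; rewrite -subr_eq0; apply/eqP/tens_eq0 => x y z.
rewrite linearB /= tens_glact /eact !tens_contr3 /link3 !ad_delta /=.
by rewrite !(eq_sym a); ring.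
Qed.

End Contractions.

(** * The listed vectors *)

(* None is the identity matrix, and Some (p, q) the matrix unit with codes p and q. *)
Definition msym : Type := option code.

Inductive vform : Type :=
| Prod of msym & msym & msym
| Contr2 of msym & msym
| Contr3 of msym.

Definition vexpr : Type := seq (int * vform).

(** This and the next two definitions are integer versions on codes of the tensor formulas, so that
    the probes are evaluated by computation. *)
Definition msym_at (o : msym) (i j : nat) : int :=
  if o is Some (p, q) then ((i == p) && (j == q))%:R else (i == j)%:R.

Definition vform_at (f : vform) (s : code3) : int :=
  let: (x, y, z) := s in
  match f with
  | Prod A B C =>
    let m o (w : code) := msym_at o w.1 w.2 in
      m A x * m B y * m C z + m A x * m B z * m C y
    + m A y * m B x * m C z + m A y * m B z * m C x
    + m A z * m B x * m C y + m A z * m B y * m C x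
  | Contr2 A P =>
    let m o (w : code) := msym_at o w.1 w.2 in
    let l (y z : code) := msym_at P y.1 z.2 * (y.2 == z.1)%:R in
    m A x * (l y z + l z y) + m A y * (l x z + l z x) + m A z * (l x y + l y x)
  | Contr3 P =>
    let l (x y z : code) := msym_at P x.1 z.2 * (x.2 == y.1)%:R * (y.2 == z.1)%:R in
    l x y z + l x z y + l y x z + l y z x + l z x y + l z y x
  end.

Definition vexpr_at (l : vexpr) (s : code3) : int :=
  foldr (fun f acc => f.1 * vform_at f.2 s + acc) 0 l.

Definition msym_weight (o : msym) (i : nat) : int :=
  if o is Some (p, q) then (i == p)%:R - (i == q)%:R else 0.

Definition vform_weight (f : vform) (i : nat) : int :=
  match f with
  | Prod A B C => msym_weight A i + msym_weight B i + msym_weight C i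
  | Contr2 A P => msym_weight A i + msym_weight P i
  | Contr3 P => msym_weight P i
  end.

(** The weight with entries a at the start and b at the end, read at the six codes. *)
Definition code_weight (a b : seq int) (i : nat) : int :=
  if (i < 3)%N then nth 0 a i else
  if (6 - size b <= i)%N then nth 0 b (i - (6 - size b)) else 0.

(* Bracket with the simple root vector of codes r, r + 1. *)
Definition msym_bracket (r : nat) (o : msym) : seq (int * msym) :=
  if o is Some (p, q) then
    (if p == r.+1 then [:: (1, Some (r, q))] else [::]) ++
    (if q == r then [:: (-1, Some (p, r.+1))] else [::])
  else [::].

Definition vform_bracket (r : nat) (f : vform) : vexpr :=
  match f with
  | Prod A B C => [seq (m.1, Prod m.2 B C) | m <- msym_bracket r A]
      ++ [seq (m.1, Prod A m.2 C) | m <- msym_bracket r B]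
      ++ [seq (m.1, Prod A B m.2) | m <- msym_bracket r C]
  | Contr2 A P => [seq (m.1, Contr2 m.2 P) | m <- msym_bracket r A]
      ++ [seq (m.1, Contr2 A m.2) | m <- msym_bracket r P]
  | Contr3 P => [seq (m.1, Contr3 m.2) | m <- msym_bracket r P]
  end.

Definition msym_ok (o : msym) : bool :=
  if o is Some (p, q) then (p < 3)%N && (3 <= q < 6)%N else true.

Definition vform_ok (f : vform) : bool :=
  match f with
  | Prod A B C => [&& msym_ok A, msym_ok B & msym_ok C]
  | Contr2 A P => msym_ok A && msym_ok P
  | Contr3 P => msym_ok P
  end.

Local Notation "e[ p , q ]" := (Some (p%N, q%N)) (format "e[ p ,  q ]").

(** In the order of the listed vectors, with sums written as contractions and the alternating sum
    over S_3 expanded in the order of [sum_S3]. *)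
Definition hwv_data : seq ((seq int * seq int) * vexpr) :=
  [:: (([::], [::]), [:: (1, Prod None None None)]);
      (([::], [::]), [:: (1, Contr2 None None)]);
      (([::], [::]), [:: (1, Contr3 None)]);
      (([:: 1], [:: -1]), [:: (1, Prod None None e[0, 5])]);
      (([:: 1], [:: -1]), [:: (1, Contr2 None e[0, 5])]);
      (([:: 1], [:: -1]), [:: (1, Contr2 e[0, 5] None)]);
      (([:: 1], [:: -1]), [:: (1, Contr3 e[0, 5])]);
      (([:: 2], [:: -2]), [:: (1, Prod None e[0, 5] e[0, 5])]);
      (([:: 2], [:: -2]), [:: (1, Contr2 e[0, 5] e[0, 5])]);
      (([:: 1; 1], [:: -2]),
        [:: (1, Contr2 e[0, 5] e[1, 5]); (-1, Contr2 e[1, 5] e[0, 5])]);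
      (([:: 2], [:: -1; -1]),
        [:: (1, Contr2 e[0, 5] e[0, 4]); (-1, Contr2 e[0, 4] e[0, 5])]);
      (([:: 1; 1], [:: -1; -1]),
        [:: (1, Prod None e[0, 5] e[1, 4]); (-1, Prod None e[0, 4] e[1, 5])]);
      (([:: 1; 1], [:: -1; -1]),
        [:: (1, Contr2 e[0, 5] e[1, 4]); (-1, Contr2 e[1, 5] e[0, 4]);
            (-1, Contr2 e[0, 4] e[1, 5]); (1, Contr2 e[1, 4] e[0, 5])]);
      (([:: 3], [:: -3]), [:: (1, Prod e[0, 5] e[0, 5] e[0, 5])]);
      (([:: 2; 1], [:: -1; -2]),
        [:: (1, Prod e[0, 5] e[0, 4] e[1, 5]); (-1, Prod e[0, 5] e[0, 5] e[1, 4])]);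
      (([:: 1; 1; 1], [:: -1; -1; -1]),
        [:: (1, Prod e[0, 5] e[1, 4] e[2, 3]); (-1, Prod e[1, 5] e[0, 4] e[2, 3]);
            (-1, Prod e[2, 5] e[1, 4] e[0, 3]); (-1, Prod e[0, 5] e[2, 4] e[1, 3]);
            (1, Prod e[1, 5] e[2, 4] e[0, 3]); (1, Prod e[2, 5] e[0, 4] e[1, 3])])].

Definition hwv k := nth ([::], [::], [::]) hwv_data k.

Definition probe_check : bool :=
  all (fun k => all (fun l => (vexpr_at (hwv k).2
    (nth ((0, 0), (0, 0), (0, 0))%N probes l) == 0) == (k != l)) (iota 0 16)) (iota 0 16).

Lemma probe_checkT : probe_check. Proof. by vm_compute. Qed.

Definition weight_check : bool :=
  all (fun k => [&& all (fun f => vform_ok f.2) (hwv k).2,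
    all (fun f => all (fun i =>
      vform_weight f.2 i == code_weight (hwv k).1.1 (hwv k).1.2 i) (iota 0 6)) (hwv k).2,
    (size (hwv k).1.1 <= 3)%N & (size (hwv k).1.2 <= 3)%N]) (iota 0 16).

Lemma weight_checkT : weight_check. Proof. by vm_compute. Qed.

(** * The vectors denoted by the data, their weights and their probes *)

Section Denotation.
Variables (K : numFieldType) (n : nat) (n6 : (6 <= n)%N).
Local Notation c := (code_ord n6).

Definition msym_mx (o : msym) : 'M[K]_n :=
  if o is Some (p, q) then delta_mx (c p) (c q) else 1%:M.

Definition vform_den (f : vform) : S3gl K n :=
  match f with
  | Prod A B C => prod3 (msym_mx A) (msym_mx B) (msym_mx C)
  | Contr2 A P => contr2 (msym_mx A) (msym_mx P)
  | Contr3 P => contr3 (msym_mx P)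
  end.

Definition vexpr_den (l : vexpr) : S3gl K n :=
  \sum_(f <- l) f.1%:~R *: vform_den f.2.

Lemma msym_mxE o i j : msym_ok o -> (i < 6)%N -> (j < 6)%N ->
  msym_mx o (c i) (c j) = (msym_at o i j)%:~R.
Proof.
move=> oo i6 j6; case: o oo => [[p q] oo|_]; rewrite mxE /= rmorph_nat; last by rewrite c_neq.
case/and3P: oo => p3 _ q6; by rewrite !c_neq // (leq_trans p3).
Qed.

Lemma code3_okP x y z : code3_ok (x, y, z) ->
  [/\ (x.1 < 6)%N /\ (x.2 < 6)%N, (y.1 < 6)%N /\ (y.2 < 6)%N
    & (z.1 < 6)%N /\ (z.2 < 6)%N].
Proof. by rewrite /code3_ok /code_ok; do 5![case: ifP => //]. Qed.

Lemma tens_vform f x y z : vform_ok f -> code3_ok (x, y, z) ->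
  tens (emb c x) (emb c y) (emb c z) (vform_den f) = (vform_at f (x, y, z))%:~R.
Proof.
move=> fok /code3_okP[[x1 x2] [y1 y2] [z1 z2]].
case: f fok => [A B C /and3P[Aok Bok Cok]|A P /andP[Aok Pok]|P Pok].
- by rewrite tens_prod3 /ent /emb /= !msym_mxE // !rmorphD !rmorphM.
- rewrite tens_contr2 /ent /link2 /emb /= !msym_mxE // !c_neq //.
  by rewrite !(rmorphD, rmorphM) /= !rmorph_nat.
- rewrite tens_contr3 /link3 /emb /= !msym_mxE // !c_neq //.
  by rewrite !(rmorphD, rmorphM) /= !rmorph_nat.
Qed.

Lemma tens_vexpr l x y z : all (fun f => vform_ok f.2) l -> code3_ok (x, y, z) ->
  tens (emb c x) (emb c y) (emb c z) (vexpr_den l) = (vexpr_at l (x, y, z))%:~R.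
Proof.
move=> lok sok; rewrite /vexpr_den linear_sum; elim: l lok => [|f l IHl] /=.
  by rewrite big_nil.
by case/andP=> fok /IHl; rewrite big_cons rmorphD rmorphM /= linearZ /= tens_vform // => ->.
Qed.

Definition msym_row (o : msym) : 'rV[int]_n :=
  if o is Some (p, q) then delta_mx 0 (c p) - delta_mx 0 (c q) else 0.

Lemma ent_msym_wt o x : ent (msym_mx o) x != 0 -> wt x = msym_row o.
Proof.
rewrite /ent /wt; case: o => [[p q]|]; rewrite mxE.
  by case: andP => [[/eqP-> /eqP->] //|]; rewrite eqxx.
by have [->|_] := eqVneq x.1 x.2; rewrite ?eqxx //= subrr.
Qed.

(** The matched indices y.2 and z.1 contribute opposite terms to the weight. *)
Lemma link2_msym_wt o y z : link2 (msym_mx o) y z != 0 -> wt y + wt z = msym_row o.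
Proof.
rewrite mulf_eq0 negb_or => /andP[yz]; rewrite pnatr_eq0 eqb0 negbK => /eqP e.
by rewrite /wt e addrA subrK; apply: (ent_msym_wt (x := (y.1, z.2))).
Qed.

Lemma link3_msym_wt o x y z : link3 (msym_mx o) x y z != 0 ->
  wt x + wt y + wt z = msym_row o.
Proof.
rewrite !mulf_eq0 !negb_or -andbA => /and3P[xz].
rewrite !pnatr_eq0 !eqb0 !negbK => /eqP e1 /eqP e2.
by rewrite /wt e1 e2 !addrA !subrK; apply: (ent_msym_wt (x := (x.1, z.2))).
Qed.

Definition vform_row (f : vform) : 'rV[int]_n :=
  match f with
  | Prod A B C => msym_row A + msym_row B + msym_row C
  | Contr2 A P => msym_row A + msym_row P
  | Contr3 P => msym_row P
  end.

Lemma add_neq0 (a b : K) : a + b != 0 -> (a != 0) || (b != 0).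
Proof. by have [->|] := eqVneq a 0; rewrite ?add0r. Qed.

Lemma has_weight_vform f : has_weight (vform_row f) (vform_den f).
Proof.
apply/has_weightP => x y z; case: f => [A B C|A P|P] /=.
(* All six terms are the same product with permuted slots, hence of the same total weight. *)
- rewrite tens_prod3; have prodW u v w : ent (msym_mx A) u * ent (msym_mx B) v
      * ent (msym_mx C) w != 0 -> wt u + wt v + wt w = msym_row A + msym_row B + msym_row C.
    rewrite !mulf_eq0 !negb_or -andbA => /and3P[].
    by move=> /ent_msym_wt-> /ent_msym_wt-> /ent_msym_wt->.
  by do 5?[case/add_neq0/orP]; move/prodW <-; apply/rowP => i; rewrite !mxE; ring.
- rewrite tens_contr2; have prodW u v w : ent (msym_mx A) u * (link2 (msym_mx P) v w
      + link2 (msym_mx P) w v) != 0 -> wt u + wt v + wt w = msym_row A + msym_row P.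
    rewrite mulf_eq0 negb_or => /andP[/ent_msym_wt-> /add_neq0/orP[]/link2_msym_wt <-].
      by rewrite [RHS]addrA.
    by rewrite [wt w + _]addrC [RHS]addrA.
  by do 5?[case/add_neq0/orP]; move/prodW <-; apply/rowP => i; rewrite !mxE; ring.
- by rewrite tens_contr3; do 5?[case/add_neq0/orP]; move/link3_msym_wt <-;
    apply/rowP => i; rewrite !mxE; ring.
Qed.

Lemma has_weight0 lam : has_weight lam (0 : S3gl K n).
Proof. by apply/has_weightP => x y z; rewrite linear0 eqxx. Qed.

Lemma has_weight_lin lam a (p q : S3gl K n) :
  has_weight lam p -> has_weight lam q -> has_weight lam (a *: p + q).
Proof.
move=> /has_weightP pw /has_weightP qw; apply/has_weightP => x y z.
have [p0|/pw //] := eqVneq (tens x y z p) 0.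
by rewrite linearP /= p0 mulr0 add0r => /qw.
Qed.

Lemma has_weight_vexpr lam l :
  (forall f, List.In f l -> vform_row f.2 = lam) -> has_weight lam (vexpr_den l).
Proof.
rewrite /vexpr_den; elim: l => [_|f l IHl lw]; first by rewrite big_nil; apply: has_weight0.
rewrite big_cons; apply: has_weight_lin; last by apply: IHl => g gl; apply: lw; right.
by rewrite -(lw f); [apply: has_weight_vform | left].
Qed.

Lemma msym_rowE o i : msym_ok o -> (i < 6)%N -> msym_row o 0 (c i) = msym_weight o i.
Proof.
case: o => [[p q] /and3P[p3 _ q6]|_] i6; rewrite !mxE //= !c_neq //.
exact: leq_trans p3 _.
Qed.

Lemma msym_row_uncoded o i : msym_ok o -> ~~ coded i -> msym_row o 0 i = 0.
Proof.
case: o => [[p q] /and3P[p3 _ q6]|_] ui; rewrite !mxE //=.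
have [e|_] := eqVneq i (c p).
  by case/negP: ui; apply/codedP; exists p => //; apply: leq_trans p3 _.
have [e|_] := eqVneq i (c q); first by case/negP: ui; apply/codedP; exists q.
by rewrite subr0.
Qed.

Lemma vform_rowE f i : vform_ok f -> (i < 6)%N -> vform_row f 0 (c i) = vform_weight f i.
Proof.
case: f => [A B C /and3P[? ? ?]|A P /andP[? ?]|P ?] i6 /=; rewrite ?[(_ + _) _ _]mxE;
  by rewrite ?[msym_row _ _ _]msym_rowE ?mxE ?msym_rowE.
Qed.

Lemma vform_row_uncoded f i : vform_ok f -> ~~ coded i -> vform_row f 0 i = 0.
Proof.
by case: f => [A B C /and3P[? ? ?]|A P /andP[? ?]|P ?] ui /=;
  rewrite ?mxE ?msym_row_uncoded ?mxE ?msym_row_uncoded ?addr0.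
Qed.

Lemma weightE (a b : seq int) (k : 'I_n) : (size a + size b <= n)%N ->
  weight n a b 0 k = if (k < size a)%N then nth 0 a k
    else if (k < n - size b)%N then 0 else nth 0 b (k - (n - size b)).
Proof.
move=> ab; rewrite mxE nth_cat -![@size _ a]/(size a); case: ltnP => // ka.
rewrite nth_cat size_nseq; have kn := ltn_ord k.
have -> : (k - size a < n - (size a + size b))%N = (k < n - size b)%N by lia.
case: ltnP => kb; first by rewrite nth_nseq if_same.
by congr nth; lia.
Qed.

Lemma weight_coded (a b : seq int) i : (size a <= 3)%N -> (size b <= 3)%N -> (i < 6)%N ->
  weight n a b 0 (c i) = code_weight a b i.
Proof.
move=> a3 b3 i6; rewrite weightE; last by lia.
rewrite /code_weight /= /code_val; case: (ltnP i 3) => i3.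
  case: (ltnP i (size a)) => // ia; rewrite [RHS]nth_default // ifT //; lia.
rewrite ifN; last by lia.
case: (leqP (6 - size b) i) => ib.
  by rewrite ifN; [congr nth; lia | lia].
by rewrite ifT //; lia.
Qed.

Lemma weight_uncoded (a b : seq int) i : (size a <= 3)%N -> (size b <= 3)%N -> ~~ coded i ->
  weight n a b 0 i = 0.
Proof.
rewrite /coded negb_or => a3 b3 /andP[i3 i3']; rewrite weightE; last by lia.
by rewrite ifN ?ifT //; lia.
Qed.

Lemma vform_row_weight f (a b : seq int) : vform_ok f ->
  (size a <= 3)%N -> (size b <= 3)%N ->
  all (fun i => vform_weight f i == code_weight a b i) (iota 0 6) ->
  vform_row f = weight n a b.
Proof.
move=> fok a3 b3 /allP fw; apply/rowP => i.
have [/codedP[k k6 ->]|ui] := boolP (coded i).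
  by rewrite vform_rowE // weight_coded //; apply/eqP/fw; rewrite mem_iota.
by rewrite vform_row_uncoded // weight_uncoded.
Qed.

Lemma hwv_ok k : (k < 16)%N -> all (fun f => vform_ok f.2) (hwv k).2.
Proof.
move=> k16; have /allP/(_ k) := weight_checkT.
by rewrite mem_iota => /(_ k16)/and4P[].
Qed.

Lemma hwv_has_weight k : (k < 16)%N ->
  has_weight (weight n (hwv k).1.1 (hwv k).1.2) (vexpr_den (hwv k).2).
Proof.
move=> k16; have /allP/(_ k) := weight_checkT.
rewrite mem_iota => /(_ k16)/and4P[]; move: (hwv k) => [[a b] l] /= lok lw a3 b3.
apply: has_weight_vexpr; elim: l lok lw => //= f l IHl /andP[fok lok] /andP[fw lw] g.
by case=> [<-|]; [apply: vform_row_weight | apply: IHl].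
Qed.

Lemma hwv_probe k l : (k < 16)%N -> (l < 16)%N ->
  (val3 (fun x y z => tens x y z (vexpr_den (hwv k).2)) c
     (nth ((0, 0), (0, 0), (0, 0))%N probes l) == 0) = (k != l).
Proof.
move=> k16 l16; have /allP/(_ k) := probe_checkT.
rewrite mem_iota => /(_ k16)/allP/(_ l); rewrite mem_iota => /(_ l16)/eqP <-.
have : all code3_ok probes by [].
move/allP/(_ (nth ((0, 0), (0, 0), (0, 0))%N probes l)); rewrite mem_nth // => /(_ isT).
case: (nth _ _ _) => [[x y] z] ok; rewrite /val3 tens_vexpr ?hwv_ok //.
by rewrite intr_eq0.
Qed.

End Denotation.

(** * The raising operators kill the listed vectors *)

Section HW.
Variables (K : numFieldType) (n : nat) (n6 : (6 <= n)%N).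
Local Notation c := (code_ord n6).
Local Notation mx := (msym_mx K n6).
Local Notation den := (vexpr_den K n6).

(* The codes r such that the indices coded by r and r + 1 are consecutive for all n. *)
Definition simple_root r := (r \in [:: 0; 1; 3; 4])%N.

Lemma ad_msym r o : simple_root r -> msym_ok o ->
  ad (delta_mx (c r) (c r.+1)) (mx o) = \sum_(m <- msym_bracket r o) m.1%:~R *: mx m.2.
Proof.
move=> rr; case: o => [[p q] /and3P[p3 q3 q6]|_]; last first.
  by rewrite big_nil /ad mulmx1 mul1mx subrr.
have r5 : (r.+1 < 6)%N by move: rr; rewrite /simple_root !inE => /or4P[] /eqP->.
have p6 := leq_trans p3 (isT : 3 <= 6)%N.
rewrite /ad !mul_delta_mx_cond !c_neq // ?(ltnW r5) // [r.+1 == p]eq_sym.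
rewrite /msym_bracket big_cat /=.
congr (_ + _); case: eqP => _;
  by rewrite ?mulr0n ?oppr0 ?big_nil // big_cons big_nil addr0 /= ?scale1r // mulrNz scaleN1r.
Qed.

(** The row is among the first three indices and the column among the last three, so a simple root
    operator acts nontrivially only if it joins two of the first three or two of the last three. *)
Lemma ad_msym0 (a a' : 'I_n) o : a' = a.+1 :> nat ->
  (forall r, simple_root r -> a != c r) -> msym_ok o -> ad (delta_mx a a') (mx o) = 0.
Proof.
move=> aa ar; case: o => [[p q] /and3P[p3 q3 q6]|_]; last by rewrite /ad mulmx1 mul1mx subrr.
have a'n := ltn_ord a'.
have a0 := ar 0%N isT; have a1 := ar 1%N isT; have a3 := ar 3%N isT; have a4 := ar 4%N isT.
rewrite -!(inj_eq val_inj) /= /code_val /= in a0 a1 a3 a4.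
rewrite /ad !mul_delta_mx_cond.
have -> : (a' == c p) = false.
  by apply/eqP => /(congr1 val); rewrite /= /code_val p3; lia.
have -> : (c q == a) = false.
  apply/eqP => /(congr1 val); rewrite /= /code_val ifN; last by lia.
  lia.
by rewrite subrr.
Qed.

Lemma glact_vform a a' f : glact (delta_mx a a') (vform_den K n6 f) =
  match f with
  | Prod A B C => prod3 (ad (delta_mx a a') (mx A)) (mx B) (mx C)
      + prod3 (mx A) (ad (delta_mx a a') (mx B)) (mx C)
      + prod3 (mx A) (mx B) (ad (delta_mx a a') (mx C))
  | Contr2 A P => contr2 (ad (delta_mx a a') (mx A)) (mx P)
      + contr2 (mx A) (ad (delta_mx a a') (mx P))
  | Contr3 P => contr3 (ad (delta_mx a a') (mx P))
  end.
Proof.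
case: f => [A B C|A P|P] /=; [exact: glact_prod3|exact: glact_contr2|exact: glact_contr3].
Qed.

Lemma glact_vform_bracket r f : simple_root r -> vform_ok f ->
  glact (delta_mx (c r) (c r.+1)) (vform_den K n6 f) = den (vform_bracket r f).
Proof.
move=> rr; rewrite glact_vform /vexpr_den.
case: f => [A B C /and3P[Aok Bok Cok]|A P /andP[Aok Pok]|P Pok] /=;
  rewrite ?big_cat !big_map /= !ad_msym // ?addrA.
- rewrite -[prod3 (\sum_(_ <- _) _) _ _]/(prod3_at1 _ _ _).
  rewrite -[prod3 _ (\sum_(_ <- _) _) _]/(prod3_at2 _ _ _) !linear_sum.
  by congr (_ + _ + _); apply: eq_bigr => m _; rewrite linearZ.
- rewrite -[contr2 (\sum_(_ <- _) _) _]/(contr2_at _ _) !linear_sum.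
  by congr (_ + _); apply: eq_bigr => m _; rewrite linearZ.
- by rewrite linear_sum; apply: eq_bigr => m _; rewrite linearZ.
Qed.

Lemma glact_vform0 (a a' : 'I_n) f : a' = a.+1 :> nat ->
  (forall r, simple_root r -> a != c r) -> vform_ok f ->
  glact (delta_mx a a') (vform_den K n6 f) = 0.
Proof.
move=> aa ar; rewrite glact_vform.
case: f => [A B C /and3P[Aok Bok Cok]|A P /andP[Aok Pok]|P Pok] /=; rewrite !ad_msym0 //.
- by rewrite -[prod3 0 _ _]/(prod3_at1 _ _ _) -[prod3 _ 0 _]/(prod3_at2 _ _ _) !linear0 !addr0.
- by rewrite -[contr2 0 _]/(contr2_at _ _) !linear0 addr0.
- by rewrite linear0.
Qed.

(** The brackets cancel, in some cases only after using the commutativity of the product. *)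
Lemma hwv_data_bracket k r : (k < 16)%N -> simple_root r ->
  den (flatten [seq [seq (f.1 * g.1, g.2) | g <- vform_bracket r f.2]
         | f <- (hwv k).2]) = 0.
Proof.
rewrite /simple_root !inE => k16 /or4P[] /eqP-> {r}.
all: case: k k16 => [|[|[|[|[|[|[|[|[|[|[|[|[|[|[|[|k]]]]]]]]]]]]]]]] // _.
all: rewrite /vexpr_den ?(big_cons, big_nil) // addr0 /=.
all: try by rewrite ?scale1r ?scaleN1r ?addrN ?addNr.
all: apply: S3gl_eq; rewrite !(val_S3glD, val_S3glZ, val_prod3) !rmorph_int linear0.
all: ring.
Qed.

Lemma glact_hwv_code k r : (k < 16)%N -> simple_root r ->
  glact (delta_mx (c r) (c r.+1)) (den (hwv k).2) = 0.
Proof.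
move=> k16 rr; rewrite -[RHS](hwv_data_bracket k16 rr) /vexpr_den linear_sum.
elim: (hwv k).2 (hwv_ok k16) => [|f l IHl] /=; first by rewrite !big_nil.
case/andP=> fok /IHl; rewrite big_cons big_cat big_map /= => ->; congr (_ + _).
rewrite linearZ /= glact_vform_bracket // /vexpr_den scaler_sumr.
by apply: eq_bigr => g _; rewrite scalerA rmorphM.
Qed.

Lemma glact_hwv k (a a' : 'I_n) : (k < 16)%N -> a' = a.+1 :> nat ->
  glact (delta_mx a a') (den (hwv k).2) = 0.
Proof.
move=> k16 aa.
have [/hasP[r rr /eqP ar]|nor] := boolP (has (fun r => a == c r) [:: 0; 1; 3; 4]%N).
  have -> : a' = c r.+1.
    apply: val_inj; rewrite [LHS]aa ar /= /code_val; move: rr; rewrite !inE.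
    by case/or4P=> /eqP-> /=; lia.
  by rewrite ar glact_hwv_code.
rewrite /vexpr_den linear_sum; elim: (hwv k).2 (hwv_ok k16) => [|f l IHl] /=.
  by rewrite big_nil.
case/andP=> fok /IHl; rewrite big_cons => ->.
rewrite addr0 linearZ /= glact_vform0 ?scaler0 //.
by move=> r rr; move/hasPn: nor => /(_ r rr).
Qed.

End HW.

(** * Independence and completeness through the probes *)

Section Complete.
Variables (K : numClosedFieldType) (n : nat) (n6 : (6 <= n)%N).
Local Notation c := (code_ord n6).
Local Notation den := (vexpr_den K n6).

(** E_{a,b} is the bracket of E_{a,b-1} and E_{b-1,b}; the induction is on b - a. *)
Lemma upper_killed_simple (p : S3gl K n) :
  (forall a a' : 'I_n, a' = a.+1 :> nat -> glact (delta_mx a a') p = 0) ->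
  upper_killed p.
Proof.
move=> p0 a b ab; move: {2}(b - a.+1)%N (erefl (b - a.+1)%N) => m.
elim: m b ab => [|m IHm] b ab bam; first by apply: p0; lia.
have b1 : (b.-1 < n)%N by have := ltn_ord b; lia.
pose b' := Ordinal b1; have := glact_bracket (delta_mx a b') (delta_mx b' b) p.
have -> : glact (delta_mx b' b) p = 0 by apply: p0 => /=; lia.
have ab' : (a < b')%N by rewrite /=; lia.
have bm : (b' - a.+1)%N = m by rewrite /=; lia.
rewrite (IHm _ ab' bm).
rewrite !linear0 add0r mul_delta_mx mul_delta_mx_0 ?subr0 => [/esym //|].
by apply/eqP => ba; move: ab; rewrite ba ltnn.
Qed.

Lemma hwv_upper_killed k : (k < 16)%N -> upper_killed (den (hwv k).2).
Proof. by move=> k16; apply: upper_killed_simple => a a'; apply: glact_hwv. Qed.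

Definition probe l : S3gl K n -> K := fun p =>
  val3 (fun x y z => tens x y z p) c (nth ((0, 0), (0, 0), (0, 0))%N probes l).

Lemma probe_linear l : scalar (probe l).
Proof.
move=> a p q; rewrite /probe; case: (nth _ _ _) => [[x y] z].
by rewrite /val3 linearP.
Qed.
HB.instance Definition _ l := GRing.isLinear.Build K _ _ _ (probe l) (probe_linear l).

Lemma probe_comb (a : 'I_16 -> K) (l : 'I_16) :
  probe l (\sum_(k < 16) a k *: den (hwv k).2) = a l * probe l (den (hwv l).2).
Proof.
rewrite linear_sum (bigD1 l) //= big1 ?addr0 => [|k kl]; first by rewrite linearZ.
have /eqP -> : probe l (a k *: den (hwv k).2) == 0; last by [].
by rewrite linearZ mulf_eq0 hwv_probe // kl orbT.
Qed.

Lemma probe_diag (k : 'I_16) : probe k (den (hwv k).2) != 0.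
Proof. by rewrite hwv_probe // negbK. Qed.

Lemma hwv_free (a : 'I_16 -> K) :
  \sum_(k < 16) a k *: den (hwv k).2 = 0 -> forall k, a k = 0.
Proof.
move=> a0 k; have := probe_comb a k; rewrite a0 linear0 => /esym/eqP.
by rewrite mulf_eq0 (negPf (probe_diag k)) orbF => /eqP.
Qed.

Lemma upper_killed_probes_eq0 (d : S3gl K n) : upper_killed d ->
  (forall l : 'I_16, probe l d = 0) -> d = 0.
Proof.
move=> du d0; apply: tens_eq0.
apply: (highest_weight_tensor_eq0 (n6 := n6) (fun x y z => tensC x y z d)
  (fun x y z => tensAC x y z d)) => [a b ab x y z|p].

  by have := tens_glact a b d x y z; rewrite du // linear0 => /esym.
case/(nthP ((0, 0), (0, 0), (0, 0))%N) => l l16 <-; exact: (d0 (Ordinal l16)).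
Qed.

(** Subtracting from d the combination with the same probes leaves a vector killed by the raising
    operators with all probes zero. *)
Lemma hwv_complete (d : S3gl K n) : upper_killed d ->
  d \in (\sum_(k < 16) <[den (hwv k).2]>)%VS.
Proof.
move=> du; pose a (k : 'I_16) := probe k d / probe k (den (hwv k).2).
suff -> : d = \sum_k a k *: den (hwv k).2.
  by apply: memv_sumr => k _; rewrite memvZ ?memv_line.
apply/eqP; rewrite -subr_eq0; apply/eqP/upper_killed_probes_eq0 => [i j ij|l].
  rewrite linearB /= du // sub0r linear_sum big1 ?oppr0 // => k _.
  by rewrite linearZ /= hwv_upper_killed // scaler0.
by rewrite linearB /= probe_comb /a divfK ?probe_diag // subrr.
Qed.

End Complete.

(** * Identification of the encoded vectors with the listed ones *)

Section Listed.
Variables (K : numFieldType) (n : nat) (n6 : (6 <= n)%N).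
Local Notation c := (code_ord n6).

Lemma E_delta (i j : nat) (a b : 'I_n) : i = a.+1 -> j = b.+1 ->
  E i j = delta_mx a b :> 'M[K]_n.
Proof. by move=> -> ->; apply/matrixP => k l; rewrite !mxE !eqSS. Qed.

Lemma sum_1n (F : nat -> S3gl K n) : \sum_(1 <= i < n.+1) F i = \sum_(i < n) F i.+1.
Proof. by rewrite big_add1 big_mkord. Qed.

(** E_{a,b} E_{i,j} is zero unless i = b, so one of the two sums in [contr2] collapses. *)
Lemma sum_1n_contr2 (A : 'M[K]_n) (p q : nat) (a b : 'I_n) : p = a.+1 -> q = b.+1 ->
  \sum_(1 <= i < n.+1) prod3 A (E p i) (E i q) = contr2 A (delta_mx a b).
Proof.
move=> pa qb; rewrite sum_1n /contr2 [RHS](bigD1 b) //=.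
rewrite [X in _ + X]big1 ?addr0 => [|i ib]; last first.
  rewrite big1 // => j _; rewrite mul_delta_mx_0 1?eq_sym //.
  by rewrite -[prod3 _ 0 _]/(prod3_at2 _ _ _) linear0.
apply: eq_bigr => i _; rewrite mul_delta_mx.
by rewrite (@E_delta _ _ a i) // (@E_delta _ _ i b).
Qed.

Lemma sum_1n_contr2_1 (A : 'M[K]_n) :
  \sum_(1 <= i < n.+1) \sum_(1 <= j < n.+1) prod3 A (E i j) (E j i) = contr2 A 1%:M.
Proof.
rewrite sum_1n; apply: eq_bigr => i _; rewrite sum_1n; apply: eq_bigr => j _.
by rewrite mul1mx (@E_delta _ _ i j) // (@E_delta _ _ j i).
Qed.

Lemma sum_1n_contr3_1 :
  \sum_(1 <= i < n.+1) \sum_(1 <= j < n.+1) \sum_(1 <= k < n.+1)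
     prod3 (E i j) (E j k) (E k i) = contr3 1%:M :> S3gl K n.
Proof.
rewrite sum_1n; apply: eq_bigr => i _; rewrite sum_1n; apply: eq_bigr => j _.
rewrite sum_1n; apply: eq_bigr => k _.
by rewrite mul1mx (@E_delta _ _ i j) // (@E_delta _ _ j k) // (@E_delta _ _ k i).
Qed.

Lemma sum_1n_contr3 (p q : nat) (a b : 'I_n) : p = a.+1 -> q = b.+1 ->
  \sum_(1 <= i < n.+1) \sum_(1 <= j < n.+1) prod3 (E p i) (E i j) (E j q)
  = contr3 (delta_mx a b) :> S3gl K n.
Proof.
move=> pa qb; rewrite sum_1n /contr3 [RHS](bigD1 b) //=.
rewrite [X in _ + X]big1 ?addr0 => [|i ib]; last first.
  rewrite big1 // => j _; rewrite big1 // => k _; rewrite mul_delta_mx_0 1?eq_sym //.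
  by rewrite -[prod3 0 _ _]/(prod3_at1 _ _ _) linear0.
apply: eq_bigr => i _; rewrite sum_1n; apply: eq_bigr => j _; rewrite mul_delta_mx.
by rewrite (@E_delta _ _ a i) // (@E_delta _ _ i j) // (@E_delta _ _ j b).
Qed.

Lemma sum_S3 (V : lmodType K) (F : 'I_3 -> 'I_3 -> 'I_3 -> V) :
  let i0 := inord 0 in let i1 := inord 1 in let i2 := inord 2 in
  \sum_(s : 'S_3) (-1) ^+ s *: F (s i0) (s i1) (s i2) =
  F i0 i1 i2 - F i1 i0 i2 - F i2 i1 i0 - F i0 i2 i1 + F i1 i2 i0 + F i2 i0 i1.
Proof.
move=> i0 i1 i2.
have n01 : i0 != i1 by rewrite -(inj_eq val_inj) /= !inordK.
have n02 : i0 != i2 by rewrite -(inj_eq val_inj) /= !inordK.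
have n12 : i1 != i2 by rewrite -(inj_eq val_inj) /= !inordK.
pose l : seq 'S_3 := [:: 1%g; tperm i0 i1; tperm i0 i2; tperm i1 i2;
  (tperm i0 i1 * tperm i0 i2)%g; (tperm i0 i2 * tperm i0 i1)%g].
have i01 : i0 == i1 = false by apply/negbTE.
have i02 : i0 == i2 = false by apply/negbTE.
have i12 : i1 == i2 = false by apply/negbTE.
have i10 : i1 == i0 = false by rewrite eq_sym.
have i20 : i2 == i0 = false by rewrite eq_sym.
have i21 : i2 == i1 = false by rewrite eq_sym.
have E := (permM, perm1, permE, i01, i02, i12, i10, i20, i21, eqxx).
have ul : uniq l.
  pose val2 (s : 'S_3) := (s i0, s i1); apply: (map_uniq (f := val2)).
  by rewrite /l /val2 /= !(permM, perm1) !permE /= !E /= !inE !xpair_eqE !E.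
have pl : perm_eq (index_enum 'S_3) l.
  apply: uniq_perm => // [|s]; first by rewrite /index_enum -enumT enum_uniq.
  rewrite mem_index_enum; apply/esym; apply: contraT => sl.
  (* A permutation outside l would make seven, but S_3 has six elements. *)
  have : (size (s :: l) <= #|'S_3|)%N.
    by rewrite cardE uniq_leq_size //= ?sl // => u; rewrite mem_enum.
  by rewrite card_Sn.
rewrite (perm_big _ pl) /l !big_cons big_nil /= addr0.
rewrite !odd_permM !odd_tperm !odd_perm1 ?n01 ?n02 ?n12 /=.
rewrite !expr0 !expr1 !scale1r !scaleN1r !(permM, perm1) !permE /= !E /=.
by rewrite !addrA.
Qed.

Lemma listed_vectorsE : listed_vectors K n =
  [seq (weight n d.1.1 d.1.2, vexpr_den K n6 d.2) | d <- hwv_data].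
Proof.
have r0 : 1%N = (c 0).+1 by [].
have r1 : 2%N = (c 1).+1 by [].
have r2 : 3%N = (c 2).+1 by [].
have r3 : (n - 2)%N = (c 3).+1 by rewrite /= /code_val /=; lia.
have r4 : (n - 1)%N = (c 4).+1 by rewrite /= /code_val /=; lia.
have r5 : n = (c 5).+1 by rewrite /= /code_val /=; lia.
have e05 := E_delta r0 r5; have e04 := E_delta r0 r4; have e03 := E_delta r0 r3.
have e15 := E_delta r1 r5; have e14 := E_delta r1 r4; have e13 := E_delta r1 r3.
have e25 := E_delta r2 r5; have e24 := E_delta r2 r4; have e23 := E_delta r2 r3.
have sE := (fun A => sum_1n_contr2 A r0 r5, fun A => sum_1n_contr2 A r1 r5,
  fun A => sum_1n_contr2 A r0 r4, fun A => sum_1n_contr2 A r1 r4,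
  sum_1n_contr3 r0 r5, sum_1n_contr2_1, sum_1n_contr3_1).
pose F (i j k : 'I_3) : S3gl K n := prod3 (E i.+1 n) (E j.+1 (n - 1)) (E k.+1 (n - 2)).
have S3E := sum_S3 F; rewrite /F !inordK // in S3E.
rewrite /listed_vectors /hwv_data /vexpr_den /=.
congr [:: _, _, _, _, _, _, _, _, _, _, _, _, _, _, _ & [:: _]]; congr (_, _).
all: rewrite ?(big_cons, big_nil) addr0 /= ?mulrNz ?scaleN1r !scale1r ?S3E.
all: rewrite ?(big_split, sumrN) /= ?sE ?(e05, e04, e03, e15, e14, e13, e25, e24, e23).
all: by rewrite ?addrA.
Qed.

End Listed.

(** * Decomposition of S^3(gl_n) along the listed vectors *)

Theorem mainTheorem3 (R : realType) (n : nat) (n_ge6 : (6 <= n)%N) :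
  let L := listed_vectors R[i] n in
  (forall k : 'I_(size L),
     highest_weight_vector (nth (0, 0) L k).1 (nth (0, 0) L k).2) /\
  exists W : 'I_(size L) -> {vspace S3gl R[i] n},
    [/\ forall k : 'I_(size L), GLirreducible (W k),
        directv (\sum_(k < size L) W k),
        (\sum_(k < size L) W k)%VS = fullv
      & forall k : 'I_(size L), (nth (0, 0) L k).2 \in W k].
Proof.
move=> L.
have LE k : (k < 16)%N -> nth (0, 0) L k =
    (weight n (hwv k).1.1 (hwv k).1.2, vexpr_den R[i] n_ge6 (hwv k).2).
  by move=> k16; rewrite /L (listed_vectorsE _ n_ge6) (nth_map ([::], [::], [::])).
have Lk (k : 'I_(size L)) : (k < 16)%N by exact: ltn_ord.
split=> [k|].
  rewrite LE //=; split=> [||i /andP[i1 i_n]]; last 1 first.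
  - have i1n : (i.-1 < n)%N by lia.
    rewrite (@E_delta _ _ _ _ (Ordinal i1n) (Ordinal i_n)) /=; [|lia|by []].
    by apply: glact_hwv => //=; lia.
  (* The vector is nonzero because its own probe is. *)
  - apply: contraNneq (@probe_diag R[i] n n_ge6 (Ordinal (Lk k))) => v0.
    by rewrite v0 linear0.
  - exact: hwv_has_weight.
have vE (k : 'I_(size L)) : (nth (0, 0) L k).2 = vexpr_den R[i] n_ge6 (hwv k).2.
  by rewrite LE.
have [W [Wirr Wdir Wfull Wv]] := highest_weight_decomposition
  (fun k : 'I_16 => @hwv_upper_killed R[i] n n_ge6 k (ltn_ord k))
  (fun k => @hwv_has_weight R[i] n n_ge6 k (ltn_ord k))
  (@hwv_free R[i] n n_ge6) (@hwv_complete R[i] n n_ge6).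
by exists W; split=> // k; rewrite vE.
Qed.
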